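(* Let $m\in\mathbb{N}^+$. For $i=0,\dots,m-1$ define $$z^{(m)}_{i,p}(x)=\frac{1}{M^{(m)}_{i,p}}\,u^{(m)}_p\Big(\frac{|x|}{(M^{(m)}_{i,p})^{\frac{p-1}{2}}}\Big),\qquad x\in\widetilde T^{(m)}_{i,p}:=(M^{(m)}_{i,p})^{\frac{p-1}{2}}T^{(m)}_{i,p},$$ where $T^{(m)}_{i,p}=\bigcup_{j=i}^{m-1}B^{(m)}_{j,p}$. Let $U(x)=\big(\frac{N(N-2)}{N(N-2)+|x|^2}\big)^{\frac{N-2}{2}}$. Then as $p\to p_S^-$: $z^{(m)}_{0,p}\to U$ in $C^2_{loc}(\mathbb{R}^N)$, and, if $m\geq2$, $(-1)^iz^{(m)}_{i,p}\to U$ in $C^2_{loc}(\mathbb{R}^N\setminus\{0\})$ for every $i=1,\dots,m-1$. (Convergence in $C^2_{loc}(D)$ means: every compact $K\subset D$ is contained in the domain of the functions for $p$ close to $p_S$, and the $C^2(K)$-distance to $U$ tends to $0$.)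
   Context: Standing setting: $N\geq3$, $B$ unit ball of $\mathbb{R}^N$ centered at $0$, $p_S=\frac{N+2}{N-2}$. $u^{(m)}_p$ is the unique radial solution of $-\Delta u=|u|^{p-1}u$ in $B$, $u=0$ on $\partial B$, with exactly $m$ nodal regions and $u^{(m)}_p(0)>0$. Nodal radii $0<r^{(m)}_{1,p}<\dots<r^{(m)}_{m-1,p}<r^{(m)}_{m,p}:=1$; nodal regions $B^{(m)}_{0,p}=\{|x|<r^{(m)}_{1,p}\}$, $B^{(m)}_{i,p}=\{r^{(m)}_{i,p}<|x|<r^{(m)}_{i+1,p}\}$; $M^{(m)}_{i,p}=\max_{B^{(m)}_{i,p}}|u^{(m)}_p|$. *)

(* Defs.v *)
(* Points of R^N are represented as
   x : nat -> R, of which only the coordinates 0..N-1 are used: the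
   (semi)norm, distances, partial derivatives all only involve them. *)
From Stdlib Require Import Reals Lra Lia.
Open Scope R_scope.

Definition pt := nat -> R.

Fixpoint sumN (n : nat) (f : nat -> R) : R :=
  match n with O => 0 | S n' => sumN n' f + f n' end.

Definition norm (N : nat) (x : pt) : R := sqrt (sumN N (fun k => x k ^ 2)).
Definition dist (N : nat) (x y : pt) : R := norm N (fun k => x k - y k).
Definition origin : pt := fun _ => 0.

Definition pS (N : nat) : R := (INR N + 2) / (INR N - 2).

Definition spow (p s : R) : R :=
  if Req_EM_T s 0 then 0 else Rpower (Rabs s) (p - 1) * s.

Definition upd (x : pt) (k : nat) (t : R) : pt :=
  fun j => if Nat.eqb j k then t else x j.

Definition partial_at (f : pt -> R) (k : nat) (x : pt) (l : R) : Prop :=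
  derivable_pt_lim (fun t => f (upd x k t)) (x k) l.

Definition partial2_at (N : nat) (f : pt -> R) (k j : nat) (x : pt) (l : R) : Prop :=
  exists (g : pt -> R) (d : R), 0 < d /\
    (forall y, dist N y x < d -> partial_at f k y (g y)) /\ partial_at g j x l.

Definition continuous_on (N : nat) (f : pt -> R) (S : pt -> Prop) : Prop :=
  forall x, S x -> forall eps, 0 < eps -> exists d, 0 < d /\
    forall y, S y -> dist N y x < d -> Rabs (f y - f x) < eps.

Definition ballB (N : nat) (x : pt) : Prop := norm N x < 1.

Definition is_solution (N : nat) (p : R) (u : pt -> R) : Prop :=
  (exists (D1 : nat -> pt -> R) (D2 : nat -> nat -> pt -> R),
     (forall k, (k < N)%nat -> forall x, ballB N x -> partial_at u k x (D1 k x)) /\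
     (forall k j, (k < N)%nat -> (j < N)%nat -> forall x, ballB N x ->
        partial_at (D1 k) j x (D2 k j x)) /\
     (forall k, (k < N)%nat -> continuous_on N (D1 k) (ballB N)) /\
     (forall k j, (k < N)%nat -> (j < N)%nat -> continuous_on N (D2 k j) (ballB N)) /\
     (forall x, ballB N x -> - sumN N (fun k => D2 k k x) = spow p (u x))) /\
  continuous_on N u (fun x => norm N x <= 1) /\
  (forall x, norm N x = 1 -> u x = 0).

Definition radial (N : nat) (u : pt -> R) : Prop :=
  forall x y, norm N x = norm N y -> u x = u y.

Definition open_set (N : nat) (U : pt -> Prop) : Prop :=
  forall x, U x -> exists d, 0 < d /\ forall y, dist N y x < d -> U y.

Definition connected (N : nat) (S : pt -> Prop) : Prop :=
  ~ exists U V : pt -> Prop, open_set N U /\ open_set N V /\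
      (forall x, S x -> U x \/ V x) /\ (exists x, S x /\ U x) /\
      (exists x, S x /\ V x) /\ (forall x, S x -> U x -> V x -> False).

Definition is_nodal_region (N : nat) (u : pt -> R) (C : pt -> Prop) : Prop :=
  (exists x, C x) /\ (forall x, C x -> ballB N x /\ u x <> 0) /\ connected N C /\
  (forall D, connected N D -> (forall x, C x -> D x) ->
     (forall x, D x -> ballB N x /\ u x <> 0) -> forall x, D x -> C x).

Definition nodal_region (N : nat) (r : nat -> R) (i : nat) (x : pt) : Prop :=
  (i = O /\ norm N x < r 1%nat) \/ ((1 <= i)%nat /\ r i < norm N x < r (S i)).

Definition nodal_radii (N : nat) (u : pt -> R) (m : nat) (r : nat -> R) : Prop :=
  0 < r 1%nat /\ (forall j, (1 <= j < m)%nat -> r j < r (S j)) /\ r m = 1 /\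
  (forall i, (i < m)%nat -> is_nodal_region N u (nodal_region N r i)) /\
  (forall C, is_nodal_region N u C ->
     exists i, (i < m)%nat /\ forall x, C x <-> nodal_region N r i x).

Definition is_max_abs (f : pt -> R) (S : pt -> Prop) (M : R) : Prop :=
  (exists x, S x /\ Rabs (f x) = M) /\ (forall x, S x -> Rabs (f x) <= M).

Definition Tset (N m : nat) (r : nat -> R) (i : nat) (x : pt) : Prop :=
  exists j, (i <= j < m)%nat /\ nodal_region N r j x.

Definition rescale (p M : R) (x : pt) : pt := fun k => x k / Rpower M ((p - 1) / 2).

Definition zfun (p M : R) (u : pt -> R) (x : pt) : R := u (rescale p M x) / M.
Definition Ttilde (N m : nat) (r : nat -> R) (i : nat) (p M : R) (x : pt) : Prop :=
  Tset N m r i (rescale p M x).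

Definition Ububble (N : nat) (x : pt) : R :=
  Rpower (INR N * (INR N - 2) / (INR N * (INR N - 2) + norm N x ^ 2)) ((INR N - 2) / 2).

Definition compact (N : nat) (K : pt -> Prop) : Prop :=
  (exists R0, forall x, K x -> norm N x <= R0) /\
  (forall x, (forall eps, 0 < eps -> exists y, K y /\ dist N x y < eps) -> K x).

Definition C2close (N : nat) (f g : pt -> R) (K : pt -> Prop) (eps : R) : Prop :=
  forall x, K x ->
    Rabs (f x - g x) <= eps /\
    (forall k, (k < N)%nat -> exists a, partial_at (fun y => f y - g y) k x a /\ Rabs a <= eps) /\
    (forall k j, (k < N)%nat -> (j < N)%nat ->
       exists l, partial2_at N (fun y => f y - g y) k j x l /\ Rabs l <= eps).

Definition C2loc_conv (N : nat) (f : R -> pt -> R) (Om : R -> pt -> Prop)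
    (D : pt -> Prop) (g : pt -> R) : Prop :=
  forall K, compact N K -> (forall x, K x -> D x) ->
    (exists d, 0 < d /\ forall p, pS N - d < p < pS N -> forall x, K x -> Om p x) /\
    (forall eps, 0 < eps -> exists d, 0 < d /\
       forall p, pS N - d < p < pS N -> C2close N (f p) g K eps).

(* Main.v *)
(** With a = 2/(p-1), the Emden-Fowler variables w = r^a v and y = r w' of the radial profile v
    satisfy r y' = d y + b w - |w|^(p-1) w, where d = 2a - (N-2) > 0 tends to 0 as p tends to p_S.
    The energy E = y^2/2 - b w^2/2 + |w|^(p+1)/(p+1) starts from 0 at r = 0 and r E' = d y^2.
    On each nodal interval |w| increases and then decreases, because y' < 0 where y = 0 and E > 0;
    this bounds the growth of sqrt (2E + C) there by the factor (1+d)/(1-d), so that E tends to 0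
    uniformly on the ball.  At the radius s where |v| reaches its maximum M on the i-th nodal interval,
    v' = 0 and E >= |w|^(p+1)/(p+1), while |w| is the a-th power of the rescaled radius
    s M^((p-1)/2); hence the rescaled peak tends to the origin.  Beyond its peak the rescaled
    profile takes values in (0,1] and solves an initial value problem that a Gronwall estimate compares with
    the one solved by U; as U > 0, this also pushes the next zero to infinity. *)
From Stdlib Require Import Reals Lra Lia Psatz FunctionalExtensionality Classical.
From Coquelicot Require Import Coquelicot.
Require Import Defs.
Open Scope R_scope.

(** * Calculus on the line *)

(** In the variable ln s the energy gains the integral of d y^2 over intervals whose length has no
    bound (the first one starts at minus infinity), so the smallness of d alone does not make the
    gain small. What is bounded is the variation of w on a nodal interval: S = sqrt (2 E + C)
    satisfies |S'| <= d |w'|, so the gain of S costs at most d times twice the maximum of w,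
    whatever the length. The constant C is forced by the term - b w^2 / 2, which prevents E alone
    from controlling y and w. For d = 0 the energy is conserved and U lies on the level E = 0; since
    m is fixed, the product of at most m growth factors still tends to 1 and keeps every nodal
    interval close to that level. Near the origin closeness in C^1 does not control the second
    derivatives, which contain v'/s. For i = 0 the difference of the two equations is therefore
    integrated once more in divergence form, which gains the missing factor s. *)

Lemma derive_nonneg_le (f df : R -> R) (a b : R) :
  a <= b -> (forall t, a <= t <= b -> is_derive f t (df t)) ->
  (forall t, a < t < b -> 0 <= df t) -> f a <= f b.
Proof.
  intros Hab Hd Hp.
  destruct (Req_dec a b) as [->|Hne]; [lra|].
  destruct (MVT_cor2 f df a b) as [c [Hc1 Hc2]]; [lra| |].
  - intros c Hc. apply is_derive_Reals, Hd, Hc.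
  - specialize (Hp c Hc2). nra.
Qed.

Lemma derive_pos_lt (f df : R -> R) (a b : R) :
  a < b -> (forall t, a <= t <= b -> is_derive f t (df t)) ->
  (forall t, a < t < b -> 0 < df t) -> f a < f b.
Proof.
  intros Hab Hd Hp.
  destruct (MVT_cor2 f df a b) as [c [Hc1 Hc2]]; [lra| |].
  - intros c Hc. apply is_derive_Reals, Hd, Hc.
  - specialize (Hp c Hc2). nra.
Qed.

Lemma continuous_eps (f : R -> R) (x eps : R) :
  continuous f x -> 0 < eps ->
  exists d, 0 < d /\ forall y, Rabs (y - x) < d -> Rabs (f y - f x) < eps.
Proof.
  intros Hc He.
  apply (proj1 (filterlim_locally f (f x))) with (eps := mkposreal eps He) in Hc.
  destruct Hc as [d Hd]. exists d. split; [apply cond_pos|].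
  intros y Hy. apply Hd. exact Hy.
Qed.

Lemma is_derive_continuous (f : R -> R) (x l : R) : is_derive f x l -> continuous f x.
Proof. intros H. apply (ex_derive_continuous f). exists l; exact H. Qed.

Lemma is_derive_eps (f : R -> R) (x l eps : R) :
  is_derive f x l -> 0 < eps ->
  exists d, 0 < d /\ forall y, Rabs (y - x) < d ->
    Rabs (f y - f x - l * (y - x)) <= eps * Rabs (y - x).
Proof.
  intros H He. apply is_derive_Reals in H.
  destruct (H eps He) as [d Hd]. exists d. split; [apply cond_pos|].
  intros y Hy. destruct (Req_dec y x) as [->|Hne].
  - replace (f x - f x - l * (x - x)) with 0 by ring. rewrite Rabs_R0.
    pose proof (Rabs_pos (x - x)). nra.
  - specialize (Hd (y - x)). replace (x + (y - x)) with y in Hd by ring.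
    assert (Hn : y - x <> 0) by lra.
    specialize (Hd Hn Hy).
    replace (f y - f x - l * (y - x)) with (((f y - f x) / (y - x) - l) * (y - x)) by (field; lra).
    rewrite Rabs_mult. apply Rmult_le_compat_r; [apply Rabs_pos|lra].
Qed.

Lemma derive_neg_crossing (f : R -> R) (x l : R) :
  is_derive f x l -> f x = 0 -> l < 0 ->
  exists d, 0 < d /\ (forall y, x < y < x + d -> f y < 0) /\ (forall y, x - d < y < x -> 0 < f y).
Proof.
  intros H H0 Hl. destruct (is_derive_eps f x l (- l / 2) H) as [d [Hd Hy]]; [lra|].
  exists d. split; [exact Hd|split]; intros y Hxy.
  - specialize (Hy y). rewrite (Rabs_pos_eq (y - x)) in Hy by lra.
    assert (K := Hy ltac:(lra)). apply Rabs_le_between in K. nra.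
  - specialize (Hy y). rewrite (Rabs_left (y - x)) in Hy by lra.
    assert (K := Hy ltac:(lra)). apply Rabs_le_between in K. nra.
Qed.

(** At the last point where f <= 0 continuity forces f = 0; the derivative is negative there, so f
    is negative just to the right, against the choice of the point. *)
Lemma no_upcrossing (f df : R -> R) (a b : R) :
  a <= b -> (forall t, a <= t <= b -> is_derive f t (df t)) ->
  (forall t, a <= t <= b -> f t = 0 -> df t < 0) -> f a <= 0 -> f b <= 0.
Proof.
  intros Hab Hd Hz Ha.
  destruct (Rle_lt_dec (f b) 0) as [|Hb]; [assumption|exfalso].
  destruct (completeness (fun s => a <= s <= b /\ f s <= 0)) as [z [Hub Hlub]].
  { exists b. intros s [Hs _]; lra. }
  { exists a. split; [lra|assumption]. }
  assert (Haz : a <= z) by (apply Hub; split; [lra|assumption]).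
  assert (Hzb : z <= b) by (apply Hlub; intros s [Hs _]; lra).
  assert (Hpos : forall s, z < s <= b -> 0 < f s).
  { intros s Hs. apply Rnot_le_lt. intros K. assert (s <= z) by (apply Hub; split; [lra|assumption]). lra. }
  assert (Hcont := is_derive_continuous f z (df z) (Hd z (conj Haz Hzb))).
  assert (Hz0 : f z <= 0).
  { apply Rnot_lt_le. intros K.
    destruct (continuous_eps f z (f z) Hcont K) as [d [Hd0 Hy]].
    assert (z <= z - d / 2); [|lra].
    apply Hlub. intros s [Hs1 Hs2]. apply Rnot_lt_le. intros K2.
    assert (s <= z) by (apply Hub; split; assumption).
    assert (K3 := Hy s ltac:(rewrite Rabs_left1; lra)).
    apply Rabs_lt_between in K3. lra. }
  assert (Hzb' : z < b).
  { destruct Hzb as [?| ->]; [assumption|lra]. }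
  assert (Hz1 : 0 <= f z).
  { apply Rnot_lt_le. intros K.
    destruct (continuous_eps f z (- f z) Hcont) as [d [Hd0 Hy]]; [lra|].
    set (s := Rmin b (z + d / 2)).
    assert (Hs : z < s <= b) by (unfold s, Rmin; destruct Rle_dec; lra).
    assert (Hs' : s <= z + d / 2) by (apply Rmin_r).
    assert (K3 := Hy s ltac:(rewrite Rabs_pos_eq; lra)).
    apply Rabs_lt_between in K3. specialize (Hpos s Hs). lra. }
  assert (Hfz : f z = 0) by lra.
  destruct (derive_neg_crossing f z (df z)) as [d [Hd0 [Hr _]]]; auto.
  set (s := Rmin b (z + d / 2)).
  assert (Hs : z < s <= b) by (unfold s, Rmin; destruct Rle_dec; lra).
  assert (Hs' : s <= z + d / 2) by (apply Rmin_r).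
  specialize (Hr s ltac:(lra)). specialize (Hpos s Hs). lra.
Qed.

(** Applied to y = s w', this produces the single turning point of w on a nodal interval. The point
    z is the supremum of the places where f > 0; [no_upcrossing] leaves no gap to its left. *)
Lemma sign_split (f df : R -> R) (a b : R) :
  a <= b -> (forall t, a <= t <= b -> is_derive f t (df t)) ->
  (forall t, a <= t <= b -> f t = 0 -> df t < 0) -> 0 < f a ->
  exists z, a <= z <= b /\ (forall s, a <= s < z -> 0 < f s) /\ (forall s, z < s <= b -> f s <= 0).
Proof.
  intros Hab Hd Hz Ha.
  destruct (completeness (fun s => a <= s <= b /\ 0 < f s)) as [z [Hub Hlub]].
  { exists b. intros s [Hs _]; lra. }
  { exists a. split; [lra|assumption]. }
  exists z. split; [split|split].
  - apply Hub; split; [lra|assumption].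
  - apply Hlub; intros s [Hs _]; lra.
  - intros s Hs. apply Rnot_le_lt. intros K.
    assert (z <= s); [|lra]. apply Hlub. intros t [Ht1 Ht2].
    apply Rnot_lt_le. intros Hst.
    assert (f t <= 0); [|lra].
    apply (no_upcrossing f df s t); try lra; intros; [apply Hd|apply Hz]; auto; lra.
  - intros s Hs. apply Rnot_lt_le. intros K.
    assert (s <= z); [|lra]. apply Hub. split; [|assumption].
    assert (a <= z) by (apply Hub; split; [lra|assumption]). lra.
Qed.

Lemma no_zero_pos (f : R -> R) (a b : R) :
  a <= b -> (forall t, a <= t <= b -> continuous f t) ->
  (forall t, a <= t <= b -> f t <> 0) -> (0 < f a <-> 0 < f b).
Proof.
  intros Hab Hc Hnz.
  assert (Hna := Hnz a ltac:(lra)). assert (Hnb := Hnz b ltac:(lra)).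
  assert (Hp : forall t, a <= t <= b -> continuity_pt f t).
  { intros t Ht. apply continuity_pt_filterlim, Hc, Ht. }
  destruct (Req_dec a b) as [->|Hne]; [tauto|].
  split; intros H; apply Rnot_le_lt; intros K.
  - destruct (Ranalysis5.IVT_interv (fun t => - f t) a b) as [z [Hz1 Hz2]]; try lra.
    + intros t Ht. apply continuity_pt_opp, Hp, Ht.
    + apply (Hnz z Hz1). lra.
  - destruct (Ranalysis5.IVT_interv f a b) as [z [Hz1 Hz2]]; try lra; auto.
    apply (Hnz z Hz1 Hz2).
Qed.

(** * Real powers, the nonlinearity and its primitive *)

Lemma is_derive_Rpower (x y : R) : 0 < x -> is_derive (fun t => Rpower t y) x (y * Rpower x y / x).
Proof.
  intros Hx. apply is_derive_Reals.
  replace (y * Rpower x y / x) with (y * Rpower x (y - 1)); [apply derivable_pt_lim_power, Hx|].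
  unfold Rminus. rewrite Rpower_plus, Rpower_Ropp, Rpower_1 by assumption. field. lra.
Qed.

Lemma Rpower_pos (x y : R) : 0 < Rpower x y.
Proof. apply exp_pos. Qed.

Lemma Rpower_1_l (y : R) : Rpower 1 y = 1.
Proof. unfold Rpower. rewrite ln_1, Rmult_0_r. apply exp_0. Qed.

Lemma Rpower_base_lt1 (x y z : R) : 0 < x <= 1 -> y <= z -> Rpower x z <= Rpower x y.
Proof.
  intros Hx Hyz. unfold Rpower.
  assert (ln x <= 0).
  { rewrite <- ln_1. destruct (proj2 Hx) as [H| ->]; [|lra]. left; apply ln_increasing; lra. }
  destruct (Req_dec (z * ln x) (y * ln x)) as [->|Hne]; [lra|].
  left. apply exp_increasing. nra.
Qed.

Lemma Rpower_le1 (x y : R) : 0 < x <= 1 -> 0 <= y -> Rpower x y <= 1.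
Proof. intros Hx Hy. rewrite <- (Rpower_O x) by lra. apply Rpower_base_lt1; assumption. Qed.

Lemma spow_pos (p s : R) : 0 < s -> spow p s = Rpower s p.
Proof.
  intros Hs. unfold spow. destruct Req_EM_T; [lra|].
  rewrite Rabs_pos_eq by lra. rewrite <- (Rpower_1 s) at 2 by assumption.
  rewrite <- Rpower_plus. f_equal; ring.
Qed.

Lemma spow_0 (p : R) : spow p 0 = 0.
Proof. unfold spow. destruct Req_EM_T; lra. Qed.

Lemma spow_opp (p s : R) : spow p (- s) = - spow p s.
Proof.
  unfold spow. repeat destruct Req_EM_T; try lra. rewrite Rabs_Ropp. ring.
Qed.

Lemma spow_scale (p c s : R) : 0 < c -> spow p (c * s) = Rpower c p * spow p s.
Proof.
  intros Hc. destruct (Rtotal_order s 0) as [H|[->|H]].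
  - replace (c * s) with (- (c * - s)) by ring. replace s with (- - s) at 2 by ring.
    rewrite (spow_opp p (c * - s)), (spow_opp p (- s)), !spow_pos, <- Rpower_mult_distr;
      first [ring | nra].
  - rewrite Rmult_0_r, spow_0. ring.
  - rewrite !spow_pos, <- Rpower_mult_distr; first [ring | nra].
Qed.

Lemma spow_small (p s : R) : 1 < p -> Rabs s <= 1 -> Rabs (spow p s) <= Rabs s.
Proof.
  intros Hp Hs. unfold spow. destruct Req_EM_T as [->|Hne]; [lra|].
  rewrite Rabs_mult, (Rabs_pos_eq (Rpower _ _)) by (left; apply Rpower_pos).
  assert (0 < Rabs s) by (apply Rabs_pos_lt; assumption).
  assert (Rpower (Rabs s) (p - 1) <= 1) by (apply Rpower_le1; lra). nra.
Qed.

(** The primitive |s|^(p+1)/(p+1) of [spow p]. It is built from [spow] because [Rpower] takes the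
    value 1 at base 0, whereas the primitive has to vanish there. *)
Definition potential (p s : R) : R := s * spow p s / (p + 1).

Lemma potential_opp (p s : R) : potential p (- s) = potential p s.
Proof. unfold potential. rewrite spow_opp. unfold Rdiv; ring. Qed.

Lemma potential_pos (p s : R) : 0 < s -> potential p s = Rpower s (p + 1) / (p + 1).
Proof.
  intros Hs. unfold potential. rewrite spow_pos by assumption.
  rewrite Rpower_plus, Rpower_1 by assumption. unfold Rdiv; ring.
Qed.

Lemma is_derive_potential_pos (p s : R) : 1 < p -> 0 < s -> is_derive (potential p) s (spow p s).
Proof.
  intros Hp Hs.
  apply (is_derive_ext_loc (fun t => Rpower t (p + 1) / (p + 1))).
  - exists (mkposreal s Hs). intros t Ht. symmetry. apply potential_pos.
    apply Rabs_lt_between' in Ht. simpl in Ht. lra.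
  - assert (H := is_derive_Rpower s (p + 1) Hs).
    rewrite spow_pos by assumption.
    apply (is_derive_scal_l _ _ _ (/ (p + 1))) in H.
    eapply is_derive_ext; [|replace (Rpower s p) with (scal ((p + 1) * Rpower s (p + 1) / s) (/ (p + 1))); [exact H|]].
    + reflexivity.
    + unfold scal; simpl; unfold mult; simpl. rewrite Rpower_plus, Rpower_1 by assumption. field. lra.
Qed.

Lemma is_derive_potential (p s : R) : 1 < p -> is_derive (potential p) s (spow p s).
Proof.
  intros Hp. destruct (Rtotal_order s 0) as [H|[->|H]].
  - apply (is_derive_ext (fun t => potential p (- t))); [intros; apply potential_opp|].
    replace (spow p s) with (scal (-1) (spow p (- s))).
    + apply (is_derive_comp (potential p) Ropp); [apply is_derive_potential_pos; lra|].
      auto_derive; [trivial|ring].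
    + unfold scal; simpl; unfold mult; simpl. rewrite spow_opp. ring.
  - rewrite spow_0. apply is_derive_Reals. intros eps He.
    (* At 0 the difference quotient is [spow p h / (p + 1)], which [spow_small] bounds by |h| once
       |h| <= 1. *)
    assert (Hd : 0 < Rmin 1 eps) by (apply Rmin_pos; lra).
    exists (mkposreal _ Hd). simpl. intros h Hh Hhd.
    unfold potential. rewrite Rplus_0_l, spow_0.
    replace ((h * spow p h / (p + 1) - 0 * 0 / (p + 1)) / h - 0) with (spow p h / (p + 1)) by (field; lra).
    assert (H1 := Rmin_l 1 eps). assert (H2 := Rmin_r 1 eps).
    assert (H3 := spow_small p h Hp ltac:(lra)).
    unfold Rdiv. rewrite Rabs_mult, (Rabs_pos_eq (/ _)) by (left; apply Rinv_0_lt_compat; lra).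
    assert (/ (p + 1) < 1) by (rewrite <- Rinv_1; apply Rinv_lt_contravar; lra).
    assert (0 < / (p + 1)) by (apply Rinv_0_lt_compat; lra).
    pose proof (Rabs_pos (spow p h)). nra.
  - apply is_derive_potential_pos; assumption.
Qed.

Lemma potential_small (p s : R) : 1 < p -> Rabs s <= 1 -> Rabs (potential p s) <= Rabs s.
Proof.
  intros Hp Hs. unfold potential, Rdiv. rewrite !Rabs_mult.
  assert (H := spow_small p s Hp Hs).
  rewrite (Rabs_pos_eq (/ _)) by (left; apply Rinv_0_lt_compat; lra).
  assert (/ (p + 1) < 1) by (rewrite <- Rinv_1; apply Rinv_lt_contravar; lra).
  assert (0 < / (p + 1)) by (apply Rinv_0_lt_compat; lra).
  pose proof (Rabs_pos (spow p s)). pose proof (Rabs_pos s).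
  assert (Rabs s * Rabs (spow p s) <= Rabs s * 1) by (apply Rmult_le_compat_l; lra).
  nra.
Qed.

Lemma potential_nonneg (p s : R) : 1 < p -> 0 <= potential p s.
Proof.
  intros Hp. assert (H : forall t, 0 < t -> 0 <= potential p t).
  { intros t Ht. rewrite potential_pos by assumption.
    apply Rdiv_le_0_compat; [left; apply Rpower_pos|lra]. }
  destruct (Rtotal_order s 0) as [K|[->|K]].
  - rewrite <- potential_opp. apply H; lra.
  - unfold potential. lra.
  - apply H, K.
Qed.

(** * Emden-Fowler energy *)

(** The interval is symmetric because the profile is the trace of a radial function on a whole axis:
    derivatives at 0 are then two-sided. The equation, singular at 0, is imposed for s > 0 only. *)
Definition is_profile (n p : R) (v v1 v2 : R -> R) : Prop :=
  (forall s, -1 < s < 1 -> is_derive v s (v1 s)) /\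
  (forall s, -1 < s < 1 -> is_derive v1 s (v2 s)) /\
  v1 0 = 0 /\
  (forall s, 0 < s < 1 -> v2 s = - (n - 1) / s * v1 s - spow p (v s)).

Definition ef_a (p : R) : R := 2 / (p - 1).
Definition ef_d (n p : R) : R := 2 * ef_a p - (n - 2).
Definition ef_b (n p : R) : R := ef_a p * (n - 2 - ef_a p).

Definition ef_w (p : R) (v : R -> R) (s : R) : R := Rpower s (ef_a p) * v s.
Definition ef_y (p : R) (v v1 : R -> R) (s : R) : R :=
  Rpower s (ef_a p) * (s * v1 s + ef_a p * v s).
Definition ef_E (n p : R) (v v1 : R -> R) (s : R) : R :=
  ef_y p v v1 s ^ 2 / 2 - ef_b n p * ef_w p v s ^ 2 / 2 + potential p (ef_w p v s).

(** With c = (-1)^i this reduces every nodal interval to one on which the profile is positive. *)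
Lemma profile_scale (n p c : R) (v v1 v2 : R -> R) :
  c = 1 \/ c = -1 -> is_profile n p v v1 v2 ->
  is_profile n p (fun s => c * v s) (fun s => c * v1 s) (fun s => c * v2 s).
Proof.
  intros Hc (H1 & H2 & H3 & H4). split; [|split; [|split]].
  - intros s Hs. apply (is_derive_scal v s c (v1 s)). auto.
  - intros s Hs. apply (is_derive_scal v1 s c (v2 s)). auto.
  - rewrite H3. ring.
  - intros s Hs. rewrite H4 by assumption.
    destruct Hc as [->| ->].
    + rewrite !Rmult_1_l. ring.
    + replace (-1 * v s) with (- v s) by ring. rewrite spow_opp. unfold Rdiv; ring.
Qed.

Lemma ef_E_scale (n p c : R) (v v1 : R -> R) (s : R) :
  c = 1 \/ c = -1 -> ef_E n p (fun t => c * v t) (fun t => c * v1 t) s = ef_E n p v v1 s.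
Proof.
  intros Hc. unfold ef_E, ef_y, ef_w. destruct Hc as [->| ->].
  - rewrite !Rmult_1_l. reflexivity.
  - replace (Rpower s (ef_a p) * (-1 * v s)) with (- (Rpower s (ef_a p) * v s)) by ring.
    rewrite potential_opp. unfold Rdiv. ring.
Qed.

Lemma ef_w_derive (n p : R) (v v1 v2 : R -> R) (s : R) :
  is_profile n p v v1 v2 -> 0 < s < 1 ->
  is_derive (ef_w p v) s (ef_y p v v1 s / s).
Proof.
  intros (H1 & H2 & H3 & H4) Hs.
  replace (ef_y p v v1 s / s) with
    (plus (mult (ef_a p * Rpower s (ef_a p) / s) (v s)) (mult (Rpower s (ef_a p)) (v1 s))).
  - apply (is_derive_mult (fun t => Rpower t (ef_a p)) v);
      [apply is_derive_Rpower; lra|apply H1; lra|intros; apply Rmult_comm].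
  - unfold plus, mult; simpl. unfold ef_y. field. lra.
Qed.

Lemma ef_y_derive (n p : R) (v v1 v2 : R -> R) (s : R) :
  is_profile n p v v1 v2 -> 1 < p -> 0 < s < 1 ->
  is_derive (ef_y p v v1) s
    ((ef_d n p * ef_y p v v1 s + ef_b n p * ef_w p v s - spow p (ef_w p v s)) / s).
Proof.
  intros (H1 & H2 & H3 & H4) Hp Hs.
  assert (Hin : is_derive (fun t => t * v1 t + ef_a p * v t) s (v1 s + s * v2 s + ef_a p * v1 s)).
  { assert (K1 := H1 s ltac:(lra)). assert (K2 := H2 s ltac:(lra)).
    auto_derive.
    - split; [exists (v2 s); exact K2|split; [exists (v1 s); exact K1|trivial]].
    - replace (Derive (fun x => v1 x) s) with (v2 s) by (symmetry; apply is_derive_unique, K2).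
      replace (Derive (fun x => v x) s) with (v1 s) by (symmetry; apply is_derive_unique, K1).
      ring. }
  eapply (fun l => is_derive_ext _ _ s l (fun t => eq_refl)).
  assert (Hm := is_derive_mult (fun t => Rpower t (ef_a p)) _ s _ _
    (is_derive_Rpower s (ef_a p) (proj1 Hs)) Hin Rmult_comm).
  match type of Hm with is_derive _ _ ?l => match goal with |- is_derive _ _ ?l' =>
    replace l' with l; [exact Hm|] end end.
  unfold plus, mult; simpl.
  (* The choice of a gives a p = a + 2, so the nonlinearity scales like the term s^2 v'' and all
     explicit powers of s cancel. *)
  assert (Hsp : spow p (ef_w p v s) = Rpower s (ef_a p) * s * s * spow p (v s)).
  { unfold ef_w. rewrite spow_scale by apply Rpower_pos. f_equal.
    rewrite Rpower_mult. replace (ef_a p * p) with (ef_a p + 1 + 1) by (unfold ef_a; field; lra).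
    rewrite !Rpower_plus, Rpower_1 by lra. reflexivity. }
  rewrite Hsp, H4 by assumption. unfold ef_d, ef_b, ef_y, ef_w.
  field. lra.
Qed.

Lemma ef_E_derive (n p : R) (v v1 v2 : R -> R) (s : R) :
  is_profile n p v v1 v2 -> 1 < p -> 0 < s < 1 ->
  is_derive (ef_E n p v v1) s (ef_d n p * ef_y p v v1 s ^ 2 / s).
Proof.
  intros HP Hp Hs.
  assert (Hw := ef_w_derive n p v v1 v2 s HP Hs).
  assert (Hy := ef_y_derive n p v v1 v2 s HP Hp Hs).
  assert (Hpo := is_derive_potential p (ef_w p v s) Hp).
  unfold ef_E. auto_derive.
  - repeat split; eexists; [exact Hy|exact Hw|exact Hpo|exact Hw].
  - replace (Derive (fun x => ef_y p v v1 x) s) with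
      ((ef_d n p * ef_y p v v1 s + ef_b n p * ef_w p v s - spow p (ef_w p v s)) / s)
      by (symmetry; apply is_derive_unique, Hy).
    replace (Derive (fun x => ef_w p v x) s) with (ef_y p v v1 s / s)
      by (symmetry; apply is_derive_unique, Hw).
    replace (Derive (fun x => potential p x) (ef_w p v s)) with (spow p (ef_w p v s))
      by (symmetry; apply is_derive_unique, Hpo).
    field. lra.
Qed.

Lemma ef_E_mono (n p : R) (v v1 v2 : R -> R) (s t : R) :
  is_profile n p v v1 v2 -> 1 < p -> 0 < ef_d n p -> 0 < s -> s <= t -> t < 1 ->
  ef_E n p v v1 s <= ef_E n p v v1 t.
Proof.
  intros HP Hp Hd Hs Hst Ht.
  apply (derive_nonneg_le _ (fun x => ef_d n p * ef_y p v v1 x ^ 2 / x)); [assumption| |].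
  - intros x Hx. apply (ef_E_derive n p v v1 v2); auto; lra.
  - intros x Hx. apply Rdiv_le_0_compat; [|lra]. pose proof (pow2_ge_0 (ef_y p v v1 x)). nra.
Qed.

Lemma Rpower_small (a eps : R) : 0 < a -> 0 < eps ->
  exists d, 0 < d /\ forall s, 0 < s < d -> Rpower s a < eps.
Proof.
  intros Ha He. exists (Rpower eps (/ a)). split; [apply Rpower_pos|].
  intros s Hs. replace eps with (Rpower (Rpower eps (/ a)) a).
  - unfold Rpower at 1 2. apply exp_increasing, Rmult_lt_compat_l; [assumption|].
    apply ln_increasing; lra.
  - rewrite Rpower_mult. replace (/ a * a) with 1 by (field; lra). apply Rpower_1, He.
Qed.

(** Near 0 both v and v' stay bounded while s^a tends to 0, hence w, y and the three terms of E tend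
    to 0. *)
Lemma ef_E_lim0 (n p : R) (v v1 v2 : R -> R) (eps : R) :
  is_profile n p v v1 v2 -> 1 < p -> 0 < eps ->
  exists d, 0 < d /\ forall s, 0 < s < d -> Rabs (ef_E n p v v1 s) <= eps.
Proof.
  intros (H1 & H2 & H3 & H4) Hp He.
  assert (Ha : 0 < ef_a p) by (unfold ef_a; apply Rdiv_lt_0_compat; lra).
  set (a := ef_a p) in *.
  assert (C0 := is_derive_continuous v 0 _ (H1 0 ltac:(lra))).
  assert (C1 := is_derive_continuous v1 0 _ (H2 0 ltac:(lra))).
  destruct (continuous_eps v 0 1 C0 ltac:(lra)) as [d1 [Hd1 K1]].
  destruct (continuous_eps v1 0 1 C1 ltac:(lra)) as [d2 [Hd2 K2]].
  set (A := Rabs (v 0) + 1).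
  assert (HA : 1 <= A) by (unfold A; pose proof (Rabs_pos (v 0)); lra).
  (* B bounds both |v s| and |s v1 s + a v s|, using |v1 s| <= 1 and s < 1. *)
  set (B := 1 + (1 + a) * A).
  assert (HB : A <= B /\ 1 <= B) by (unfold B; split; nra).
  set (b := Rabs (ef_b n p)). assert (Hb : 0 <= b) by apply Rabs_pos.
  (* If |w| and |y| are at most tau <= 1, then |E| <= tau / 2 + b tau / 2 + tau <= (2 + b) tau. *)
  set (tau := Rmin 1 (eps / (2 + b))).
  assert (Htau : 0 < tau) by (apply Rmin_pos; [lra|apply Rdiv_lt_0_compat; lra]).
  assert (Htau1 : tau <= 1) by apply Rmin_l.
  assert (Htau2 : (2 + b) * tau <= eps).
  { assert (tau <= eps / (2 + b)) by apply Rmin_r.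
    replace eps with ((2 + b) * (eps / (2 + b))) by (field; lra).
    apply Rmult_le_compat_l; lra. }
  destruct (Rpower_small a (tau / B) Ha) as [d3 [Hd3 K3]]; [apply Rdiv_lt_0_compat; lra|].
  exists (Rmin (Rmin d1 d2) (Rmin d3 1)). split; [repeat apply Rmin_pos; lra|].
  intros s Hs.
  assert (Hs1 : s < d1 /\ s < d2 /\ s < d3 /\ s < 1).
  { destruct Hs as [_ Hs]. revert Hs. unfold Rmin. repeat destruct Rle_dec; lra. }
  specialize (K1 s ltac:(rewrite Rminus_0_r, Rabs_pos_eq; lra)).
  specialize (K2 s ltac:(rewrite Rminus_0_r, Rabs_pos_eq; lra)).
  specialize (K3 s ltac:(lra)). rewrite H3 in K2.
  assert (Hvs : Rabs (v s) <= A).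
  { unfold A. replace (v s) with (v 0 + (v s - v 0)) by ring.
    eapply Rle_trans; [apply Rabs_triang|]. lra. }
  assert (Hv1s : Rabs (v1 s) <= 1) by (rewrite Rminus_0_r in K2; lra).
  assert (Hpw := Rpower_pos s a).
  assert (HpB : Rpower s a * B < tau).
  { apply (Rmult_lt_compat_r B) in K3; [|lra]. replace (tau / B * B) with tau in K3 by (field; lra). exact K3. }
  assert (Hw : Rabs (ef_w p v s) <= tau).
  { unfold ef_w. fold a. rewrite Rabs_mult, (Rabs_pos_eq (Rpower s a)) by lra. nra. }
  assert (Hy : Rabs (ef_y p v v1 s) <= tau).
  { unfold ef_y. fold a. rewrite Rabs_mult, (Rabs_pos_eq (Rpower s a)) by lra.
    assert (Rabs (s * v1 s + a * v s) <= B); [|nra].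
    eapply Rle_trans; [apply Rabs_triang|]. rewrite !Rabs_mult, (Rabs_pos_eq s), (Rabs_pos_eq a) by lra.
    unfold B. pose proof (Rabs_pos (v1 s)). pose proof (Rabs_pos (v s)). nra. }
  assert (Hpot := potential_small p (ef_w p v s) Hp ltac:(lra)).
  unfold ef_E.
  set (w := ef_w p v s) in *. set (y := ef_y p v v1 s) in *.
  assert (Hy2 : Rabs (y ^ 2) <= tau) by (rewrite <- RPow_abs; pose proof (Rabs_pos y); simpl; nra).
  assert (Hw2 : Rabs (w ^ 2) <= tau) by (rewrite <- RPow_abs; pose proof (Rabs_pos w); simpl; nra).
  assert (Hbw : Rabs (ef_b n p * w ^ 2) <= b * tau).
  { rewrite Rabs_mult. fold b. apply Rmult_le_compat_l; assumption. }
  apply Rabs_le_between in Hy2. apply Rabs_le_between in Hbw. apply Rabs_le_between in Hpot.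
  apply Rabs_le. nra.
Qed.

(** In s v' + a v the second term tends to a v(0) > 0 and the first one to 0. This starts the first
    nodal interval with w increasing, and makes E strictly increasing there. *)
Lemma ef_y_pos_near0 (n p : R) (v v1 v2 : R -> R) :
  is_profile n p v v1 v2 -> 1 < p -> 0 < v 0 ->
  exists d, 0 < d < 1 /\ forall s, 0 < s < d -> 0 < ef_y p v v1 s.
Proof.
  intros (H1 & H2 & H3 & H4) Hp Hv.
  assert (Ha : 0 < ef_a p) by (unfold ef_a; apply Rdiv_lt_0_compat; lra).
  assert (C0 := is_derive_continuous v 0 _ (H1 0 ltac:(lra))).
  assert (C1 := is_derive_continuous v1 0 _ (H2 0 ltac:(lra))).
  assert (Hp0 : 0 < ef_a p * v 0 / 4) by nra.
  destruct (continuous_eps v 0 (v 0 / 2) C0 ltac:(lra)) as [d1 [Hd1 K1]].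
  destruct (continuous_eps v1 0 (ef_a p * v 0 / 4) C1 Hp0) as [d2 [Hd2 K2]].
  exists (Rmin (Rmin d1 d2) (1/2)).
  assert (Hm : Rmin (Rmin d1 d2) (1/2) <= 1/2) by apply Rmin_r.
  split; [split; [repeat apply Rmin_pos; lra|lra]|].
  intros s Hs.
  assert (Hs1 : s < d1 /\ s < d2 /\ s < 1).
  { destruct Hs as [_ Hs]. revert Hs. unfold Rmin. repeat destruct Rle_dec; lra. }
  specialize (K1 s ltac:(rewrite Rminus_0_r, Rabs_pos_eq; lra)).
  specialize (K2 s ltac:(rewrite Rminus_0_r, Rabs_pos_eq; lra)).
  rewrite H3, Rminus_0_r in K2.
  apply Rabs_lt_between in K1. apply Rabs_lt_between in K2.
  unfold ef_y. apply Rmult_lt_0_compat; [apply Rpower_pos|]. nra.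
Qed.

(** E is nondecreasing with limit 0 at the origin, and strictly increasing at first because y > 0
    there. Strict positivity is what excludes double zeros of v and gives y' < 0 at the zeros of
    y. *)
Lemma ef_E_pos (n p : R) (v v1 v2 : R -> R) (s : R) :
  is_profile n p v v1 v2 -> 1 < p -> 0 < ef_d n p -> 0 < v 0 -> 0 < s < 1 ->
  0 < ef_E n p v v1 s.
Proof.
  intros HP Hp Hd Hv Hs.
  destruct (ef_y_pos_near0 n p v v1 v2 HP Hp Hv) as [d [Hd1 Hy]].
  set (t := Rmin s (d / 2)).
  assert (Ht : 0 < t) by (apply Rmin_pos; lra).
  assert (Ht1 : t <= s) by apply Rmin_l. assert (Ht2 : t <= d / 2) by apply Rmin_r.
  apply Rlt_le_trans with (ef_E n p v v1 t); [|apply (ef_E_mono n p v v1 v2); auto; lra].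
  assert (Hinc : forall x y, 0 < x -> x < y -> y <= t -> ef_E n p v v1 x < ef_E n p v v1 y).
  { intros x y Hx Hxy Hyt.
    apply (derive_pos_lt _ (fun x => ef_d n p * ef_y p v v1 x ^ 2 / x)); [assumption| |].
    - intros z Hz. apply (ef_E_derive n p v v1 v2); auto; lra.
    - intros z Hz. apply Rdiv_lt_0_compat; [|lra]. specialize (Hy z ltac:(lra)).
      apply Rmult_lt_0_compat; [assumption|apply pow_lt, Hy]. }
  assert (H1 := Hinc (t / 2) t ltac:(lra) ltac:(lra) ltac:(lra)).
  apply Rle_lt_trans with (ef_E n p v v1 (t / 2)); [|assumption].
  apply Rnot_lt_le. intros K.
  destruct (ef_E_lim0 n p v v1 v2 (- ef_E n p v v1 (t / 2) / 2) HP Hp ltac:(lra)) as [d2 [Hd2 K2]].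
  set (x := Rmin (t / 4) (d2 / 2)).
  assert (Hx : 0 < x) by (apply Rmin_pos; lra).
  assert (Hx1 : x <= t / 4) by apply Rmin_l. assert (Hx2 : x <= d2 / 2) by apply Rmin_r.
  specialize (K2 x ltac:(lra)). apply Rabs_le_between in K2.
  assert (H3 := Hinc x (t / 2) ltac:(lra) ltac:(lra) ltac:(lra)). lra.
Qed.

(* [C] is chosen so that [y ^ 2 + w ^ 2 <= 2 E + C]. *)
Definition ef_const (n p C : R) : Prop :=
  0 < C /\ forall w, 0 < w -> (1 + ef_b n p) * w ^ 2 <= C + 2 * potential p w.

Definition ef_k (n p : R) : R := (1 + ef_d n p) / (1 - ef_d n p).

(* With S = sqrt (2 E + C), S' = d y^2 / (s S) is at most d |w'| because |y| <= S; as w first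
   increases and then decreases and w <= S, S grows at most by the factor [ef_k] on a nodal interval. *)
Lemma nodal_energy_growth (n p C al be B : R) (v v1 v2 : R -> R) :
  is_profile n p v v1 v2 -> 1 < p -> 0 < ef_d n p < 1 -> ef_const n p C ->
  0 <= al -> be <= 1 ->
  (forall s, al < s < be -> 0 < v s) ->
  (forall s, al < s < be -> 0 < ef_E n p v v1 s) ->
  (forall eps, 0 < eps -> exists s0, al < s0 < be /\ forall s, al < s <= s0 ->
     0 < ef_y p v v1 s /\ 2 * ef_E n p v v1 s + C <= B + eps) ->
  forall s, al < s < be -> 2 * ef_E n p v v1 s + C <= ef_k n p ^ 2 * B.
Proof.
  intros HP Hp Hd [HC HCw] Hal Hbe Hv HE Hst s Hs.
  set (d := ef_d n p) in *. set (E := ef_E n p v v1) in *.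
  set (w := ef_w p v) in *. set (y := ef_y p v v1) in *.
  assert (Hk : 1 <= ef_k n p).
  { unfold ef_k. fold d. apply Rle_div_r; lra. }
  assert (Hk2 : 1 <= ef_k n p ^ 2) by (simpl; nra).
  (* The level B is only approached as s tends to [al]. One starts at some s0 with level B + eps',
     where eps' is eps divided by the growth factor. *)
  apply le_epsilon. intros eps He.
  set (eps' := eps / ef_k n p ^ 2).
  assert (He' : 0 < eps') by (apply Rdiv_lt_0_compat; lra).
  destruct (Hst eps' He') as [s0 [Hs0 Hs0']].
  replace (ef_k n p ^ 2 * B + eps) with (ef_k n p ^ 2 * (B + eps')) by (unfold eps'; field; lra).
  assert (HEs0 := HE s0 Hs0).
  destruct (Hs0' s0 ltac:(lra)) as [Hy0 HB0].
  destruct (Rle_lt_dec s s0) as [Hss|Hss].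
  { destruct (Hs0' s ltac:(lra)) as [_ K]. assert (K2 := HE s Hs). nra. }
  set (S := fun t => sqrt (2 * E t + C)).
  assert (HSpos : forall t, al < t < be -> 0 < S t).
  { intros t Ht. apply sqrt_lt_R0. specialize (HE t Ht). lra. }
  assert (HS2 : forall t, al < t < be -> S t * S t = 2 * E t + C).
  { intros t Ht. apply sqrt_sqrt. specialize (HE t Ht). lra. }
  assert (Hwpos : forall t, al < t < be -> 0 < w t).
  { intros t Ht. apply Rmult_lt_0_compat; [apply Rpower_pos|auto]. }
  assert (HSb : forall t, al < t < be -> y t ^ 2 + w t ^ 2 <= S t * S t).
  { intros t Ht. rewrite HS2 by assumption. unfold E, ef_E. fold w y.
    specialize (HCw (w t) (Hwpos t Ht)). lra. }
  assert (HSy : forall t, al < t < be -> y t <= S t /\ - S t <= y t /\ w t <= S t).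
  { intros t Ht. assert (K := HSb t Ht). assert (K1 := HSpos t Ht).
    pose proof (pow2_ge_0 (y t)). pose proof (pow2_ge_0 (w t)). repeat split; nra. }
  assert (Hdw : forall t, al < t < be -> is_derive w t (y t / t)).
  { intros t Ht. apply (ef_w_derive n p v v1 v2); auto; lra. }
  assert (HdS : forall t, al < t < be -> is_derive S t (d * y t ^ 2 / t / S t)).
  { intros t Ht. assert (KE := ef_E_derive n p v v1 v2 t HP Hp ltac:(lra)).
    assert (K0 := HE t Ht). unfold S at 1. auto_derive.
    - split; [eexists; exact KE|split; [fold E; lra|trivial]].
    - replace (Derive (fun x => E x) t) with (d * y t ^ 2 / t) by (symmetry; apply is_derive_unique, KE).
      fold (S t). assert (K1 := HSpos t Ht). field. split; lra. }
  destruct (sign_split y (fun t => (d * y t + ef_b n p * w t - spow p (w t)) / t) s0 s) as [z [Hz1 [Hz2 Hz3]]].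
  - lra.
  - intros t Ht. apply (ef_y_derive n p v v1 v2); auto; lra.
  - intros t Ht Hyt. assert (Ht' : al < t < be) by lra.
    assert (K := HE t Ht'). unfold E, ef_E in K. fold w y in K. rewrite Hyt in K.
    assert (Kw := Hwpos t Ht'). unfold potential in K.
    rewrite Hyt. apply Rmult_lt_reg_r with t; [lra|].
    unfold Rdiv. rewrite Rmult_assoc, Rinv_l, Rmult_0_l by lra.
    assert (Kp : 0 < spow p (w t)) by (rewrite spow_pos by assumption; apply Rpower_pos).
    (* This is E > 0 with y = 0, divided by w. As p + 1 > 2, it implies b w < w^p, which is y' <
       0. *)
    assert (K2 : ef_b n p * w t / 2 < spow p (w t) / (p + 1)).
    { apply Rmult_lt_reg_l with (w t); [assumption|].
      replace (w t * (ef_b n p * w t / 2)) with (ef_b n p * w t ^ 2 / 2) by field.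
      unfold Rdiv in *. simpl in K. simpl. lra. }
    assert (K3 : spow p (w t) / (p + 1) < spow p (w t) / 2).
    { apply Rmult_lt_compat_l; [assumption|]. apply Rinv_lt_contravar; lra. }
    lra.
  - assumption.
  - assert (Hz : al < z < be) by lra.
    (* Before the turning point w' > 0 and S' <= d w'; after it w' <= 0 and S' <= - d w'. Thus S - d
       w decreases on the first stretch and S + d w on the second. *)
    assert (A1 : S z - d * w z <= S s0 - d * w s0).
    { apply Ropp_le_cancel.
      apply (derive_nonneg_le (fun t => - (S t - d * w t)) (fun t => - (d * y t ^ 2 / t / S t - d * (y t / t)))).
      - lra.
      - intros t Ht. apply (is_derive_opp (fun t => S t - d * w t)).
        apply (is_derive_minus S (fun t => d * w t)); [apply HdS; lra|].
        apply (is_derive_scal w). apply Hdw. lra.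
      - intros t Ht. assert (Ht' : al < t < be) by lra.
        specialize (Hz2 t ltac:(lra)). destruct (HSy t Ht') as [L1 _]. assert (L2 := HSpos t Ht').
        replace (- (d * y t ^ 2 / t / S t - d * (y t / t))) with (d * y t * (S t - y t) / (t * S t)) by (field; lra).
        apply Rdiv_le_0_compat; [|nra]. apply Rmult_le_pos; [|lra]. nra. }
    assert (A2 : S s + d * w s <= S z + d * w z).
    { apply Ropp_le_cancel.
      apply (derive_nonneg_le (fun t => - (S t + d * w t)) (fun t => - (d * y t ^ 2 / t / S t + d * (y t / t)))).
      - lra.
      - intros t Ht. apply (is_derive_opp (fun t => S t + d * w t)).
        apply (is_derive_plus S (fun t => d * w t)); [apply HdS; lra|].
        apply (is_derive_scal w). apply Hdw. lra.
      - intros t Ht. assert (Ht' : al < t < be) by lra.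
        specialize (Hz3 t ltac:(lra)). destruct (HSy t Ht') as [_ [L1 _]]. assert (L2 := HSpos t Ht').
        replace (- (d * y t ^ 2 / t / S t + d * (y t / t))) with (d * - y t * (S t + y t) / (t * S t)) by (field; lra).
        apply Rdiv_le_0_compat; [|nra]. apply Rmult_le_pos; [|lra]. nra. }
    assert (Pz := HSy z Hz). assert (Pw0 := Hwpos s0 Hs0). assert (Pws := Hwpos s Hs).
    assert (PSz := HSpos z Hz). assert (PS0 := HSpos s0 Hs0). assert (PSs := HSpos s Hs).
    (* Since 0 < w <= S at z, the ascent costs a factor 1 / (1 - d) and the descent a factor 1 +
       d. *)
    assert (A3 : (1 - d) * S z <= S s0) by nra.
    assert (A4 : S s <= (1 + d) * S z) by nra.
    assert (A5 : S s <= ef_k n p * S s0).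
    { unfold ef_k. fold d. replace ((1 + d) / (1 - d) * S s0) with ((1 + d) * S s0 / (1 - d)) by (field; lra).
      apply Rle_div_r; [lra|]. nra. }
    rewrite <- HS2 by assumption. rewrite <- HS2 in HB0 by assumption.
    apply Rle_trans with ((ef_k n p * S s0) * (ef_k n p * S s0)); [nra|].
    replace ((ef_k n p * S s0) * (ef_k n p * S s0)) with (ef_k n p ^ 2 * (S s0 * S s0)) by ring.
    apply Rmult_le_compat_l; lra.
Qed.

Lemma pow_m1_cases (i : nat) : (-1) ^ i = 1 \/ (-1) ^ i = -1.
Proof. induction i as [|i [IH|IH]]; simpl; rewrite ?IH; lra. Qed.

(** Transfer across a zero r: there w = 0, so E > 0 forces v' to be nonzero, hence negative. Thus v
    changes sign, y is negative on a right neighbourhood, and the energy bound passes through r by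
    continuity. After a change of sign this is the starting hypothesis of [nodal_energy_growth] on
    the next interval. *)
Lemma nodal_start_succ (n p C B al r be : R) (v v1 v2 : R -> R) :
  is_profile n p v v1 v2 -> 1 < p -> 0 <= al < r -> r < be <= 1 ->
  0 < ef_E n p v v1 r ->
  v r = 0 -> (forall s, al < s < r -> 0 < v s) -> (forall s, r < s < be -> v s <> 0) ->
  (forall s, al < s < r -> 2 * ef_E n p v v1 s + C <= B) ->
  (forall s, r < s < be -> v s < 0) /\
  (forall eps, 0 < eps -> exists s0, r < s0 < be /\ forall s, r < s <= s0 ->
     ef_y p v v1 s < 0 /\ 2 * ef_E n p v v1 s + C <= B + eps).
Proof.
  intros HP Hp Hal Hbe HE Hvr Hpos Hnz HB.
  assert (HP' := HP). destruct HP' as (H1 & H2 & H3 & H4).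
  assert (HEr := ef_E_derive n p v v1 v2 r HP Hp ltac:(lra)).
  assert (Hyr := ef_y_derive n p v v1 v2 r HP Hp ltac:(lra)).
  apply is_derive_continuous in HEr. apply is_derive_continuous in Hyr.
  assert (Hwr : ef_w p v r = 0) by (unfold ef_w; rewrite Hvr; ring).
  assert (Hne : v1 r <> 0).
  { intros K. unfold ef_E, ef_y in HE. rewrite Hwr, Hvr, K in HE. unfold potential in HE. lra. }
  assert (Hdv := H1 r ltac:(lra)).
  assert (Hneg : v1 r < 0).
  { apply Rnot_le_lt. intros K.
    destruct (derive_neg_crossing (fun t => - v t) r (- v1 r)) as [d [Hd [_ Hl]]]; [|lra|lra|].
    - apply (is_derive_opp v), Hdv.
    - set (s := Rmax ((al + r) / 2) (r - d / 2)).
      assert (Hs : al < s < r /\ r - d < s) by (unfold s, Rmax; destruct Rle_dec; lra).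
      specialize (Hl s ltac:(lra)). specialize (Hpos s ltac:(lra)). lra. }
  split.
  - destruct (derive_neg_crossing v r (v1 r) Hdv Hvr Hneg) as [d [Hd [Hr _]]].
    intros s Hs. set (t := Rmin s (r + d / 2)).
    assert (Ht : r < t <= s /\ t < r + d) by (unfold t, Rmin; destruct Rle_dec; lra).
    assert (Hvt := Hr t ltac:(lra)).
    apply Rnot_le_lt. intros K. assert (Hvs := Hnz s Hs).
    assert (K2 : 0 < v t); [|lra].
    apply (no_zero_pos v t s); [lra| | |lra].
    + intros x Hx. eapply is_derive_continuous, H1. lra.
    + intros x Hx. apply Hnz. lra.
  - intros eps He.
    assert (HBr : 2 * ef_E n p v v1 r + C <= B).
    { apply le_epsilon. intros e2 He2.
      destruct (continuous_eps _ r (e2 / 2) HEr ltac:(lra)) as [d [Hd K]].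
      set (s := Rmax ((al + r) / 2) (r - d / 2)).
      assert (Hs : al < s < r /\ r - d < s) by (unfold s, Rmax; destruct Rle_dec; lra).
      specialize (K s ltac:(rewrite Rabs_left; lra)). apply Rabs_lt_between in K.
      specialize (HB s ltac:(lra)). lra. }
    assert (Hy : ef_y p v v1 r < 0).
    { unfold ef_y. rewrite Hvr. assert (K := Rpower_pos r (ef_a p)).
      assert (K2 : 0 < Rpower r (ef_a p) * (r * - v1 r)); [|lra].
      apply Rmult_lt_0_compat; [assumption|nra]. }
    destruct (continuous_eps _ r (eps / 2) HEr ltac:(lra)) as [d1 [Hd1 K1]].
    destruct (continuous_eps _ r (- ef_y p v v1 r) Hyr ltac:(lra)) as [d2 [Hd2 K2]].
    set (s0 := Rmin ((r + be) / 2) (r + Rmin d1 d2 / 2)).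
    assert (Hs0 : r < s0 < be /\ s0 < r + d1 /\ s0 < r + d2).
    { unfold s0, Rmin. repeat destruct Rle_dec; lra. }
    exists s0. split; [lra|]. intros s Hs.
    specialize (K1 s ltac:(rewrite Rabs_pos_eq; lra)).
    specialize (K2 s ltac:(rewrite Rabs_pos_eq; lra)).
    apply Rabs_lt_between in K1. apply Rabs_lt_between in K2. lra.
Qed.

Lemma ef_y_scale (p c : R) (v v1 : R -> R) (s : R) :
  ef_y p (fun t => c * v t) (fun t => c * v1 t) s = c * ef_y p v v1 s.
Proof. unfold ef_y. ring. Qed.

Lemma nodal_energy_bound (n p C : R) (v v1 v2 : R -> R) (m : nat) (r : nat -> R) :
  is_profile n p v v1 v2 -> 1 < p -> 0 < ef_d n p < 1 -> ef_const n p C -> 0 < v 0 ->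
  r O = 0 -> (forall i, (i < m)%nat -> 0 <= r i < r (S i) /\ r (S i) <= 1) ->
  (forall i, (0 < i < m)%nat -> v (r i) = 0) ->
  (forall i s, (i < m)%nat -> r i < s < r (S i) -> v s <> 0) ->
  forall i, (i < m)%nat -> forall s, r i < s < r (S i) ->
    0 < (-1) ^ i * v s /\ 2 * ef_E n p v v1 s + C <= (ef_k n p ^ 2) ^ S i * C.
Proof.
  intros HP Hp Hd HC Hv0 Hr0 Hr Hz Hnz.
  assert (HEp : forall s, 0 < s < 1 -> 0 < ef_E n p v v1 s)
    by (intros; apply (ef_E_pos n p v v1 v2); auto; lra).
  set (K := ef_k n p ^ 2).
  (* The induction carries the sign and the behaviour at the left end of interval i, at level K^i C.
     Crossing the interval multiplies the level by K, which explains the exponent [S i] in the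
     conclusion. *)
  assert (Hmain : forall i, (i < m)%nat ->
    (forall s, r i < s < r (S i) -> 0 < (-1) ^ i * v s) /\
    (forall eps, 0 < eps -> exists s0, r i < s0 < r (S i) /\ forall s, r i < s <= s0 ->
       0 < (-1) ^ i * ef_y p v v1 s /\ 2 * ef_E n p v v1 s + C <= K ^ i * C + eps)).
  2:{ intros i Hi s Hs. destruct (Hmain i Hi) as [M1 M2]. split; [auto|].
    assert (Hc := pow_m1_cases i). destruct (Hr i Hi) as [Hri1 Hri2].
    rewrite <- (ef_E_scale n p ((-1) ^ i)) by assumption.
    replace (K ^ S i * C) with (K * (K ^ i * C)) by (simpl; ring).
    apply (nodal_energy_growth n p C (r i) (r (S i)) (K ^ i * C) _ _ _ (profile_scale n p _ v v1 v2 Hc HP)); auto; try lra.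
    - intros t Ht. rewrite ef_E_scale by assumption. apply HEp. lra.
    - intros eps He. destruct (M2 eps He) as [s0 [Hs0 L]]. exists s0. split; [assumption|].
      intros t Ht. rewrite ef_E_scale, ef_y_scale by assumption. apply L, Ht. }
  assert (HP' := HP). destruct HP' as (H1 & H2 & H3 & H4).
  induction i as [|i IH]; intros Hi.
  - destruct (Hr O Hi) as [Hri1 Hri2]. rewrite Hr0 in *. split.
    + intros s Hs. simpl. rewrite Rmult_1_l.
      apply (no_zero_pos v 0 s); [lra| | |assumption].
      * intros x Hx. eapply is_derive_continuous, H1. lra.
      * intros x Hx. destruct (Req_dec x 0) as [->|Hx0]; [lra|]. apply (Hnz O); [assumption|]. rewrite Hr0. lra.
    + intros eps He.
      destruct (ef_y_pos_near0 n p v v1 v2 HP Hp Hv0) as [d1 [Hd1 K1]].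
      destruct (ef_E_lim0 n p v v1 v2 (eps / 2) HP Hp ltac:(lra)) as [d2 [Hd2 K2]].
      exists (Rmin (r 1%nat / 2) (Rmin d1 d2 / 2)).
      assert (Hs0 : 0 < Rmin (r 1%nat / 2) (Rmin d1 d2 / 2) < r 1%nat /\
        Rmin (r 1%nat / 2) (Rmin d1 d2 / 2) < d1 /\ Rmin (r 1%nat / 2) (Rmin d1 d2 / 2) < d2)
        by (unfold Rmin; repeat destruct Rle_dec; lra).
      split; [lra|]. intros s Hs. simpl. rewrite !Rmult_1_l.
      specialize (K1 s ltac:(lra)). specialize (K2 s ltac:(lra)). apply Rabs_le_between in K2. lra.
  - assert (Hi' : (i < m)%nat) by lia. specialize (IH Hi'). destruct IH as [M1 M2].
    assert (Hc := pow_m1_cases i).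
    destruct (Hr i Hi') as [Hri1 Hri2]. destruct (Hr (S i) Hi) as [Hrj1 Hrj2].
    assert (HPi := profile_scale n p _ v v1 v2 Hc HP).
    destruct (nodal_start_succ n p C (K ^ S i * C) (r i) (r (S i)) (r (S (S i))) _ _ _ HPi) as [Q1 Q2]; auto; try lra.
    + rewrite ef_E_scale by assumption. apply HEp. lra.
    + rewrite Hz by lia. ring.
    + intros s Hs Hs0. apply (Hnz (S i) s Hi Hs). destruct Hc as [Hc|Hc]; rewrite Hc in Hs0; lra.
    + replace (K ^ S i * C) with (K * (K ^ i * C)) by (simpl; ring).
      apply (nodal_energy_growth n p C (r i) (r (S i)) (K ^ i * C) _ _ _ HPi); auto; try lra.
      * intros t Ht. rewrite ef_E_scale by assumption. apply HEp. lra.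
      * intros eps He. destruct (M2 eps He) as [s0 [Hs0 L]]. exists s0. split; [assumption|].
        intros t Ht. rewrite ef_E_scale, ef_y_scale by assumption. apply L, Ht.
    + split.
      * intros s Hs. specialize (Q1 s Hs). simpl in Q1. simpl. lra.
      * intros eps He. destruct (Q2 eps He) as [s0 [Hs0 L]]. exists s0. split; [assumption|].
        intros t Ht. specialize (L t Ht). rewrite ef_E_scale, ef_y_scale in L by assumption.
        simpl in L. simpl. lra.
Qed.

(* At a critical point of [v] one has w' = a w, hence E >= |w|^(p+1)/(p+1), where |w| is the
   [ef_a]-th power of the rescaled radius. *)
Lemma critical_radius_energy (n p M s : R) (v v1 : R -> R) :
  1 < p -> 0 < ef_d n p -> 0 < s -> 0 < M -> v s = M -> v1 s = 0 ->
  Rpower (s * Rpower M ((p - 1) / 2)) (2 * ef_a p + 2) / (p + 1) <= ef_E n p v v1 s.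
Proof.
  intros Hp Hd Hs HM Hv Hv1.
  assert (Ha : 0 < ef_a p) by (unfold ef_a; apply Rdiv_lt_0_compat; lra).
  assert (Hwpos : 0 < ef_w p v s) by (unfold ef_w; rewrite Hv; apply Rmult_lt_0_compat; [apply Rpower_pos|assumption]).
  assert (Hw : ef_w p v s = Rpower (s * Rpower M ((p - 1) / 2)) (ef_a p)).
  { unfold ef_w. rewrite Hv, <- Rpower_mult_distr, Rpower_mult by (auto using Rpower_pos).
    replace ((p - 1) / 2 * ef_a p) with 1 by (unfold ef_a; field; lra).
    rewrite Rpower_1 by assumption. reflexivity. }
  assert (Hy : ef_y p v v1 s = ef_a p * ef_w p v s) by (unfold ef_y, ef_w; rewrite Hv1; ring).
  unfold ef_E. rewrite Hy, potential_pos by assumption. rewrite Hw at 3. rewrite Rpower_mult.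
  replace (ef_a p * (p + 1)) with (2 * ef_a p + 2) by (unfold ef_a; field; lra).
  (* Since a^2 - b = a d, the quadratic part of E equals a d w^2 / 2 at a critical point of v. *)
  assert (0 <= (ef_a p * ef_w p v s) ^ 2 / 2 - ef_b n p * ef_w p v s ^ 2 / 2); [|lra].
  replace ((ef_a p * ef_w p v s) ^ 2 / 2 - ef_b n p * ef_w p v s ^ 2 / 2)
    with (ef_a p * ef_d n p * ef_w p v s ^ 2 / 2) by (unfold ef_b, ef_d; field).
  pose proof (pow2_ge_0 (ef_w p v s)). assert (0 < ef_a p * ef_d n p) by nra. nra.
Qed.

(** C has to be the same for all p near q, because the limit of the growth factors is taken with C
    fixed. *)
Lemma ef_const_exists (n q : R) : 3 <= n -> 1 < q ->
  exists C, 0 < C /\ forall p, (1 + q) / 2 <= p < q -> ef_const n p C.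
Proof.
  intros Hn Hq.
  (* B bounds 1 + b, as a (n - 2 - a) is at most (n - 2)^2 / 4. The potential dominates B w^2 once
     w^(p-1) >= Y, and e is the least value of p - 1, so w >= W suffices. Below W the constant B W^2
     does the work. *)
  set (B := 1 + (n - 2) ^ 2 / 4). set (Y := B * (q + 1) / 2). set (e := (q - 1) / 2).
  set (W := Rpower Y (/ e)).
  assert (He : 0 < e) by (unfold e; lra).
  assert (HB : 1 <= B) by (unfold B; pose proof (pow2_ge_0 (n - 2)); lra).
  assert (HY : 1 <= Y) by (unfold Y; nra).
  assert (HW : 0 < W) by apply Rpower_pos.
  exists (B * W ^ 2). assert (HC : 0 < B * W ^ 2) by (apply Rmult_lt_0_compat; [lra|apply pow_lt, HW]).
  split; [assumption|]. intros p Hp. split; [assumption|]. intros w Hw.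
  assert (Hb : 1 + ef_b n p <= B).
  { unfold B, ef_b. pose proof (pow2_ge_0 (ef_a p - (n - 2) / 2)). lra. }
  assert (Hb2 : (1 + ef_b n p) * w ^ 2 <= B * w ^ 2).
  { apply Rmult_le_compat_r; [apply pow2_ge_0|assumption]. }
  destruct (Rle_lt_dec w W) as [Hle|Hlt].
  - assert (w ^ 2 <= W ^ 2) by (apply pow_incr; lra).
    assert (B * w ^ 2 <= B * W ^ 2) by (apply Rmult_le_compat_l; lra).
    assert (Hpot := potential_nonneg p w ltac:(lra)). lra.
  - rewrite potential_pos by assumption.
    assert (HwY : Y <= Rpower w (p - 1)).
    { apply Rle_trans with (Rpower W (p - 1)).
      - unfold W. rewrite Rpower_mult.
        rewrite <- (Rpower_1 Y) at 1 by lra.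
        apply Rle_Rpower; [assumption|]. replace (/ e * (p - 1)) with ((p - 1) / e) by (unfold Rdiv; ring).
        apply Rle_div_r; [assumption|]. unfold e. lra.
      - apply Rle_Rpower_l; lra. }
    assert (Hpw : Rpower w (p + 1) = w ^ 2 * Rpower w (p - 1)).
    { replace (p + 1) with (1 + 1 + (p - 1)) by ring. rewrite !Rpower_plus, Rpower_1 by assumption. ring. }
    assert (Hw2 : 0 < w ^ 2) by (apply pow_lt, Hw).
    assert (B * w ^ 2 <= 2 * (Rpower w (p + 1) / (p + 1))); [|lra].
    replace (2 * (Rpower w (p + 1) / (p + 1))) with (2 * Rpower w (p + 1) / (p + 1)) by (field; lra).
    apply (Rle_div_r (B * w ^ 2) _ (p + 1)); [lra|]. rewrite Hpw.
    assert (B * (p + 1) <= 2 * Y) by (unfold Y; nra).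
    replace (B * w ^ 2 * (p + 1)) with (w ^ 2 * (B * (p + 1))) by ring.
    replace (2 * (w ^ 2 * Rpower w (p - 1))) with (w ^ 2 * (2 * Rpower w (p - 1))) by ring.
    apply Rmult_le_compat_l; lra.
Qed.

(** The last bound, inserted in [nodal_energy_bound], leaves 2 E <= tau. The bound on [ef_a p] makes
    the exponent in [critical_radius_energy] uniform in p. *)
Lemma energy_small (n q C tau : R) (m : nat) : 3 <= n -> q = (n + 2) / (n - 2) -> 0 < tau -> 0 < C ->
  exists d, 0 < d /\ forall p, q - d < p < q ->
    (1 + q) / 2 <= p /\ 0 < ef_d n p < 1 /\ ef_a p <= 4 / (q - 1) /\
    forall i, (i < m)%nat -> (ef_k n p ^ 2) ^ S i * C <= C + tau.
Proof.
  intros Hn Hq Ht HC.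
  assert (Hq1 : q - 1 = 4 / (n - 2)) by (rewrite Hq; field; lra).
  assert (Hq2 : 0 < q - 1) by (rewrite Hq1; apply Rdiv_lt_0_compat; lra).
  assert (Hcont : continuous (fun x => (((1 + x) / (1 - x)) ^ 2) ^ m * C) 0).
  { apply (ex_derive_continuous (fun x => (((1 + x) / (1 - x)) ^ 2) ^ m * C)). auto_derive. lra. }
  destruct (continuous_eps _ 0 tau Hcont Ht) as [d1 [Hd1 K]].
  (* At the critical exponent n - 2 = 4 / (q - 1), so d = 4 (q - p) / ((p - 1) (q - 1)); with p - 1
     > (q - 1) / 2 this is at most c (q - p). *)
  set (c := 8 / ((q - 1) * (q - 1))).
  assert (Hc : 0 < c) by (apply Rdiv_lt_0_compat; nra).
  exists (Rmin ((q - 1) / 2) (Rmin (1 / c) (d1 / c))).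
  split; [repeat apply Rmin_pos; try apply Rdiv_lt_0_compat; lra|].
  intros p Hp.
  assert (Hp' : q - (q - 1) / 2 < p /\ q - p < 1 / c /\ q - p < d1 / c).
  { revert Hp. unfold Rmin. repeat destruct Rle_dec; lra. }
  destruct Hp' as [P1 [P2 P3]].
  assert (Hd : ef_d n p = 4 * (q - p) / ((p - 1) * (q - 1))).
  { unfold ef_d, ef_a. replace (n - 2) with (4 / (q - 1)); [field; lra|].
    rewrite Hq1. field. lra. }
  assert (Hdc : 0 < ef_d n p <= c * (q - p)).
  { rewrite Hd. split; [apply Rdiv_lt_0_compat; nra|].
    replace (c * (q - p)) with (4 * (q - p) / ((q - 1) / 2 * (q - 1))) by (unfold c; field; lra).
    apply Rmult_le_compat_l; [lra|]. apply Rinv_le_contravar; [nra|]. apply Rmult_le_compat_r; lra. }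
  assert (Hc1 : c * (q - p) < 1).
  { apply (Rmult_lt_compat_l c) in P2; [|assumption]. replace (c * (1 / c)) with 1 in P2 by (field; lra). lra. }
  assert (Hc2 : c * (q - p) < d1).
  { apply (Rmult_lt_compat_l c) in P3; [|assumption]. replace (c * (d1 / c)) with d1 in P3 by (field; lra). lra. }
  split; [lra|]. split; [lra|]. split.
  - unfold ef_a. replace (4 / (q - 1)) with (2 / ((q - 1) / 2)) by (field; lra).
    apply Rmult_le_compat_l; [lra|]. apply Rinv_le_contravar; lra.
  - intros i Hi.
    assert (Hk : 1 <= ef_k n p) by (unfold ef_k; apply Rle_div_r; lra).
    assert (Hk2 : 1 <= ef_k n p ^ 2) by (simpl; nra).
    apply Rle_trans with ((ef_k n p ^ 2) ^ m * C).
    + apply Rmult_le_compat_r; [lra|]. apply Rle_pow; [assumption|lia].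
    + specialize (K (ef_d n p) ltac:(rewrite Rminus_0_r, Rabs_pos_eq; lra)).
      apply Rabs_lt_between in K. fold (ef_k n p) in K.
      replace (((1 + 0) / (1 - 0)) ^ 2) with 1 in K by field. rewrite pow1 in K. lra.
Qed.

(** * Radial solutions and nodal radii *)

Lemma sumN_S (n : nat) (f : nat -> R) : sumN (S n) f = sumN n f + f n.
Proof. reflexivity. Qed.

Lemma sumN_ext (n : nat) (f g : nat -> R) :
  (forall k, (k < n)%nat -> f k = g k) -> sumN n f = sumN n g.
Proof.
  intros H. induction n as [|n IH]; simpl; [reflexivity|].
  rewrite IH, H by (try lia; intros; apply H; lia). reflexivity.
Qed.

Lemma sumN_nonneg (n : nat) (f : nat -> R) : (forall k, 0 <= f k) -> 0 <= sumN n f.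
Proof. intros H. induction n as [|n IH]; simpl; [lra|]. specialize (H n). lra. Qed.

Lemma sumN_ge (n k : nat) (f : nat -> R) : (k < n)%nat -> (forall j, 0 <= f j) -> f k <= sumN n f.
Proof.
  intros Hk H. induction n as [|n IH]; [lia|]. simpl.
  destruct (Nat.eq_dec k n) as [->|Hne].
  - pose proof (sumN_nonneg n f H). lra.
  - specialize (IH ltac:(lia)). specialize (H n). lra.
Qed.

Lemma sumN_upd (n k : nat) (x : pt) (t : R) : (k < n)%nat ->
  sumN n (fun j => upd x k t j ^ 2) = sumN n (fun j => x j ^ 2) - x k ^ 2 + t ^ 2.
Proof.
  intros Hk. induction n as [|n IH]; [lia|]. rewrite !sumN_S.
  destruct (Nat.eq_dec k n) as [->|Hne].
  - rewrite (sumN_ext n (fun j => upd x n t j ^ 2) (fun j => x j ^ 2)).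
    + unfold upd. rewrite Nat.eqb_refl. ring.
    + intros j Hj. unfold upd. replace (Nat.eqb j n) with false; [reflexivity|].
      symmetry. apply Nat.eqb_neq. lia.
  - rewrite IH by lia. unfold upd at 1. replace (Nat.eqb n k) with false; [ring|].
    symmetry. apply Nat.eqb_neq. lia.
Qed.

Lemma norm_nonneg (N : nat) (x : pt) : 0 <= norm N x.
Proof. apply sqrt_pos. Qed.

Lemma norm_sq (N : nat) (x : pt) : norm N x ^ 2 = sumN N (fun k => x k ^ 2).
Proof. apply pow2_sqrt, sumN_nonneg. intros; apply pow2_ge_0. Qed.

Lemma norm_upd (N k : nat) (x : pt) (t : R) : (k < N)%nat ->
  norm N (upd x k t) = sqrt (norm N x ^ 2 - x k ^ 2 + t ^ 2).
Proof. intros Hk. unfold norm at 1. rewrite sumN_upd, norm_sq by assumption. reflexivity. Qed.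

Lemma norm_coord (N k : nat) (x : pt) : (k < N)%nat -> Rabs (x k) <= norm N x.
Proof.
  intros Hk. rewrite <- sqrt_Rsqr_abs. apply sqrt_le_1_alt.
  replace (Rsqr (x k)) with (x k ^ 2) by (unfold Rsqr; ring).
  apply (sumN_ge N k (fun j => x j ^ 2) Hk). intros; apply pow2_ge_0.
Qed.

Lemma norm_origin (N : nat) : norm N origin = 0.
Proof.
  unfold norm. replace (sumN N (fun k => origin k ^ 2)) with 0; [apply sqrt_0|].
  induction N as [|N IH]; [reflexivity|]. rewrite sumN_S, <- IH. unfold origin. ring.
Qed.

Definition axis (t : R) : pt := upd origin 0 t.

Lemma norm_axis (N : nat) (t : R) : (0 < N)%nat -> norm N (axis t) = Rabs t.
Proof.
  intros HN. unfold axis. rewrite norm_upd, norm_origin by assumption. unfold origin.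
  rewrite <- sqrt_Rsqr_abs. f_equal. unfold Rsqr. ring.
Qed.

Lemma upd_upd (x : pt) (k : nat) (s t : R) : upd (upd x k s) k t = upd x k t.
Proof. apply functional_extensionality. intros j. unfold upd. destruct (Nat.eqb j k); reflexivity. Qed.

Lemma upd_self (x : pt) (k : nat) : upd x k (x k) = x.
Proof.
  apply functional_extensionality. intros j. unfold upd. destruct (Nat.eqb_spec j k); subst; reflexivity.
Qed.

Lemma norm_upd_axis (N k : nat) (s t : R) : (0 < k < N)%nat ->
  norm N (upd (axis s) k t) = sqrt (s ^ 2 + t ^ 2).
Proof.
  intros Hk. rewrite norm_upd, norm_axis by lia.
  f_equal. rewrite pow2_abs. unfold axis, upd, origin. destruct k as [|k]; [lia|]. simpl. ring.
Qed.

(** The planar case, which serves as induction step on the dimension in [norm_triangle].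
    Cauchy-Schwarz comes from the square of A b - a B. *)
Lemma hypot_triangle (A B a b : R) : 0 <= A -> 0 <= B ->
  sqrt ((A + B) ^ 2 + (a + b) ^ 2) <= sqrt (A ^ 2 + a ^ 2) + sqrt (B ^ 2 + b ^ 2).
Proof.
  intros HA HB.
  set (P := sqrt (A ^ 2 + a ^ 2)). set (Q := sqrt (B ^ 2 + b ^ 2)).
  assert (HP : P * P = A ^ 2 + a ^ 2) by (apply sqrt_sqrt; nra).
  assert (HQ : Q * Q = B ^ 2 + b ^ 2) by (apply sqrt_sqrt; nra).
  assert (P0 : 0 <= P) by apply sqrt_pos. assert (Q0 : 0 <= Q) by apply sqrt_pos.
  assert (HPQ : A * B + a * b <= P * Q).
  { apply Rnot_lt_le. intros K.
    assert (0 <= P * Q) by (apply Rmult_le_pos; assumption).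
    assert (K2 : (P * Q) * (P * Q) < (A * B + a * b) * (A * B + a * b)) by nra.
    replace ((P * Q) * (P * Q)) with ((P * P) * (Q * Q)) in K2 by ring.
    rewrite HP, HQ in K2. pose proof (pow2_ge_0 (A * b - a * B)). nra. }
  rewrite <- (sqrt_Rsqr (P + Q)) by lra. apply sqrt_le_1_alt. unfold Rsqr. nra.
Qed.

Lemma norm_S (N : nat) (x : pt) : norm (S N) x = sqrt (norm N x ^ 2 + x N ^ 2).
Proof. rewrite norm_sq. reflexivity. Qed.

Lemma norm_triangle (N : nat) (x y : pt) : norm N (fun k => x k + y k) <= norm N x + norm N y.
Proof.
  induction N as [|N IH].
  - unfold norm; simpl. rewrite sqrt_0. lra.
  - rewrite !norm_S.
    eapply Rle_trans; [|apply hypot_triangle; apply norm_nonneg].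
    apply sqrt_le_1_alt, Rplus_le_compat_r, pow_incr.
    split; [apply norm_nonneg|exact IH].
Qed.

Lemma dist_sym (N : nat) (x y : pt) : dist N x y = dist N y x.
Proof. unfold dist, norm. f_equal. apply sumN_ext. intros; ring. Qed.

Lemma norm_dist (N : nat) (x y : pt) : Rabs (norm N y - norm N x) <= dist N y x.
Proof.
  assert (H : forall a b, norm N a <= norm N b + dist N a b).
  { intros a b. replace (norm N a) with (norm N (fun k => b k + (a k - b k))).
    - apply norm_triangle.
    - unfold norm. f_equal. apply sumN_ext. intros; ring. }
  pose proof (H x y). pose proof (H y x). rewrite (dist_sym N x y) in *. apply Rabs_le. lra.
Qed.

Lemma dist_axis (N : nat) (s t : R) : (0 < N)%nat -> dist N (axis s) (axis t) = Rabs (s - t).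
Proof.
  intros HN. unfold dist. rewrite <- (norm_axis N (s - t) HN). f_equal.
  apply functional_extensionality. intros [|j]; unfold axis, upd, origin; simpl; ring.
Qed.

Lemma is_derive_hypot (s t : R) : 0 < s ^ 2 + t ^ 2 ->
  is_derive (fun t => sqrt (s ^ 2 + t ^ 2)) t (t / sqrt (s ^ 2 + t ^ 2)).
Proof.
  intros H. auto_derive; [simpl in *; lra|].
  replace (s * (s * 1) + t * (t * 1)) with (s ^ 2 + t ^ 2) by ring.
  field. apply Rgt_not_eq, sqrt_lt_R0, H.
Qed.

(** The equation is read on the first axis. The pure second derivative along the axis is v''; each
    of the N - 1 transverse ones is v'/s, because moving by t in such a direction changes the radius
    to sqrt (s^2 + t^2). *)
Lemma solution_profile (N : nat) (p : R) (u : pt -> R) :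
  (3 <= N)%nat -> is_solution N p u -> radial N u ->
  exists v1 v2, is_profile (INR N) p (fun t => u (axis t)) v1 v2.
Proof.
  intros HN [[D1 [D2 (A1 & A2 & _ & _ & A5)]] _] Hrad.
  assert (HN0 : (0 < N)%nat) by lia.
  set (v := fun t => u (axis t)). set (v1 := fun t => D1 O (axis t)). set (v2 := fun t => D2 O O (axis t)).
  assert (Hin : forall s, -1 < s < 1 -> ballB N (axis s)).
  { intros s Hs. unfold ballB. rewrite norm_axis by assumption. apply Rabs_def1; lra. }
  assert (Hv : forall s, -1 < s < 1 -> is_derive v s (v1 s)).
  { intros s Hs. apply is_derive_Reals. generalize (A1 O HN0 _ (Hin s Hs)).
    unfold partial_at. unfold axis at 2. unfold upd at 2. simpl.
    replace (fun t => u (upd (axis s) 0 t)) with v; [trivial|].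
    apply functional_extensionality. intros t. unfold v, axis. rewrite upd_upd. reflexivity. }
  assert (Hv1 : forall s, -1 < s < 1 -> is_derive v1 s (v2 s)).
  { intros s Hs. apply is_derive_Reals. generalize (A2 O O HN0 HN0 _ (Hin s Hs)).
    unfold partial_at. unfold axis at 2. unfold upd at 2. simpl.
    replace (fun t => D1 O (upd (axis s) 0 t)) with v1; [trivial|].
    apply functional_extensionality. intros t. unfold v1, axis. rewrite upd_upd. reflexivity. }
  assert (Huv : forall x, u x = v (norm N x)).
  { intros x. apply Hrad. rewrite norm_axis, Rabs_pos_eq by (try assumption; apply norm_nonneg). reflexivity. }
  assert (Heven : forall t, v (- t) = v t).
  { intros t. apply Hrad. rewrite !norm_axis, Rabs_Ropp by assumption. reflexivity. }
  exists v1, v2. split; [exact Hv|split; [exact Hv1|split]].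
  (* An even function has at 0 a derivative equal to its own opposite. *)
  - assert (K : is_derive v 0 (- v1 0)).
    { apply (is_derive_ext (fun t => v (- t))); [exact Heven|].
      replace (- v1 0) with (scal (-1) (v1 (-0))).
      - apply (is_derive_comp v Ropp); [rewrite Ropp_0; apply Hv; lra|auto_derive; [trivial|ring]].
      - unfold scal; simpl; unfold mult; simpl. rewrite Ropp_0. ring. }
    assert (K2 := is_derive_unique _ _ _ K). rewrite (is_derive_unique _ _ _ (Hv 0 ltac:(lra))) in K2. lra.
  - intros s Hs.
    assert (Hkk : forall k, (0 < k < N)%nat -> D2 k k (axis s) = v1 s / s).
    { intros k Hk.
      assert (Hak : axis s k = 0) by (destruct k; [lia|reflexivity]).
      assert (HD1 : forall t, s ^ 2 + t ^ 2 < 1 ->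
        D1 k (upd (axis s) k t) = t / sqrt (s ^ 2 + t ^ 2) * v1 (sqrt (s ^ 2 + t ^ 2))).
      { intros t Ht.
        assert (Hpos : 0 < s ^ 2 + t ^ 2) by nra.
        assert (Hsq : 0 < sqrt (s ^ 2 + t ^ 2) < 1).
        { split; [apply sqrt_lt_R0, Hpos|]. rewrite <- sqrt_1. apply sqrt_lt_1_alt. lra. }
        assert (Hb : ballB N (upd (axis s) k t)).
        { unfold ballB. rewrite norm_upd_axis by assumption. lra. }
        assert (L1 := A1 k ltac:(lia) _ Hb). unfold partial_at in L1.
        unfold upd at 3 in L1. rewrite Nat.eqb_refl in L1.
        apply is_derive_Reals in L1.
        assert (L2 := is_derive_comp v (fun t => sqrt (s ^ 2 + t ^ 2)) t _ _
          (Hv (sqrt (s ^ 2 + t ^ 2)) ltac:(lra)) (is_derive_hypot s t Hpos)).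
        assert (L3 : is_derive (fun t0 => u (upd (upd (axis s) k t) k t0)) t
           (t / sqrt (s ^ 2 + t ^ 2) * v1 (sqrt (s ^ 2 + t ^ 2)))).
        { eapply is_derive_ext; [|exact L2]. intros t0. rewrite upd_upd, Huv, norm_upd_axis by assumption. reflexivity. }
        apply is_derive_unique in L1. apply is_derive_unique in L3. exact (eq_trans (eq_sym L1) L3). }
      assert (L1 := A2 k k ltac:(lia) ltac:(lia) _ (Hin s ltac:(lra))). unfold partial_at in L1.
      rewrite Hak in L1. apply is_derive_Reals in L1.
      assert (Hd0 : 0 < 1 - s) by lra.
      assert (L2 : is_derive (fun t => t / sqrt (s ^ 2 + t ^ 2) * v1 (sqrt (s ^ 2 + t ^ 2))) 0 (v1 s / s)).
      { assert (Hs0 : sqrt (s ^ 2 + 0 ^ 2) = s).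
        { replace (s ^ 2 + 0 ^ 2) with (s * s) by ring. apply sqrt_square. lra. }
        assert (G1 : is_derive (fun t => sqrt (s ^ 2 + t ^ 2)) 0 0).
        { replace 0 with (0 / sqrt (s ^ 2 + 0 ^ 2)) at 2 by (rewrite Hs0; field; lra).
          apply is_derive_hypot. simpl; nra. }
        set (h := fun t => sqrt (s ^ 2 + t ^ 2)) in *.
        assert (Hh0 : h 0 = s) by exact Hs0.
        assert (G2 : is_derive v1 (h 0) (v2 s)) by (rewrite Hh0; apply Hv1; lra).
        change (is_derive (fun t => t / h t * v1 (h t)) 0 (v1 s / s)).
        auto_derive.
        - repeat split; try (eexists; eassumption). rewrite Hh0. lra.
        - replace (Derive (fun x => h x) 0) with 0 by (symmetry; apply is_derive_unique, G1).
          rewrite Hh0. field. lra. }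
      (* If |t| < 1 - s, the displaced point is still in the ball, where the formula [HD1]
         applies. *)
      assert (L3 : is_derive (fun t => D1 k (upd (axis s) k t)) 0 (v1 s / s)).
      { eapply is_derive_ext_loc; [|exact L2].
        exists (mkposreal _ Hd0). intros t Ht. symmetry. apply HD1.
        apply Rabs_lt_between' in Ht. simpl in Ht. nra. }
      apply is_derive_unique in L1. apply is_derive_unique in L3. exact (eq_trans (eq_sym L1) L3). }
    assert (Hpde := A5 _ (Hin s ltac:(lra))).
    assert (Hsum : sumN N (fun k => D2 k k (axis s)) = v2 s + (INR N - 1) * (v1 s / s)).
    { clear Hpde A5.
      assert (Hgen : forall j, (1 <= j <= N)%nat -> sumN j (fun k => D2 k k (axis s)) = v2 s + (INR j - 1) * (v1 s / s)).
      { induction j as [|j IH]; [lia|]. intros Hj. rewrite S_INR, sumN_S.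
        destruct (Nat.eq_dec j 0) as [->|Hne].
        - simpl. unfold v2. ring.
        - rewrite IH, Hkk by lia. ring. }
      apply Hgen. lia. }
    rewrite Hsum in Hpde. fold (v s) in Hpde. rewrite <- Hpde. field. lra.
Qed.

(** An open set that contains x0 also meets C, so a separation of the enlarged set would already
    separate C. *)
Lemma connected_add_limit_point (N : nat) (C : pt -> Prop) (x0 : pt) :
  connected N C -> (forall eps, 0 < eps -> exists y, C y /\ dist N y x0 < eps) ->
  connected N (fun x => C x \/ x = x0).
Proof.
  intros HC Hx0.
  assert (Hone : forall U V : pt -> Prop, open_set N U -> open_set N V ->
    (forall x, C x \/ x = x0 -> U x \/ V x) -> (exists x, (C x \/ x = x0) /\ V x) ->
    (forall x, C x \/ x = x0 -> U x -> V x -> False) -> ~ U x0).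
  { intros U V HU HV Hcov [y [Hy1 Hy2]] Hdis HUx.
    destruct (HU x0 HUx) as [d [Hd Hball]]. destruct (Hx0 d Hd) as [z [Hz1 Hz2]].
    apply HC. exists U, V. repeat split; auto.
    - exists z. split; [assumption|apply Hball, Hz2].
    - destruct Hy1 as [Hy1| ->]; [exists y; auto|].
      exfalso. apply (Hdis x0); auto.
    - intros x Hx. apply Hdis; auto. }
  intros [U [V (HU & HV & Hcov & HexU & HexV & Hdis)]].
  destruct (Hcov x0 (or_intror eq_refl)) as [K|K].
  - apply (Hone U V); auto.
  - apply (Hone V U); auto.
    + intros x Hx. destruct (Hcov x Hx); auto.
    + intros x Hx H1 H2. apply (Hdis x); auto.
Qed.

(** [nodal_radii] prescribes no value of [r 0]; region 0 is a ball, whose inner radius is set to 0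
    here to treat all regions alike. *)
Definition radius0 (r : nat -> R) (i : nat) : R := match i with O => 0 | S _ => r i end.

Lemma nodal_region_radius (N i : nat) (r : nat -> R) (x : pt) :
  nodal_region N r i x -> radius0 r i <= norm N x < r (S i).
Proof.
  intros [[-> H]|[Hi H]].
  - simpl. split; [apply norm_nonneg|assumption].
  - destruct i; [lia|]. simpl. lra.
Qed.

Lemma nodal_region_intro (N i : nat) (r : nat -> R) (x : pt) :
  radius0 r i < norm N x < r (S i) -> nodal_region N r i x.
Proof. intros H. destruct i as [|i]; [left|right]; simpl in H; repeat split; try lia; lra. Qed.

(** That u vanishes at the inner radii is a consequence of maximality: if u were nonzero at a point
    of the inner sphere of region i, adding this limit point would give a larger connected set on
    which u does not vanish. *)
Lemma nodal_radii_facts (N m : nat) (u : pt -> R) (r : nat -> R) :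
  (1 <= N)%nat -> nodal_radii N u m r ->
  (forall i, (i < m)%nat -> 0 <= radius0 r i < radius0 r (S i) /\ radius0 r (S i) <= 1) /\
  (forall i, (0 < i < m)%nat -> u (axis (radius0 r i)) = 0) /\
  (forall i s, (i < m)%nat -> radius0 r i < s < radius0 r (S i) -> u (axis s) <> 0).
Proof.
  intros HN (R1 & R2 & R3 & R4 & _).
  assert (Hpos : forall k, (1 <= k <= m)%nat -> 0 < r k).
  { induction k as [|k IH]; [lia|]. intros Hk. destruct k as [|k]; [assumption|].
    specialize (R2 (S k) ltac:(lia)). specialize (IH ltac:(lia)). lra. }
  assert (Hup : forall j k, (k + j = m)%nat -> (1 <= k)%nat -> r k <= 1).
  { induction j as [|j IH]; intros k Hkj Hk.
    - replace k with m by lia. lra.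
    - specialize (IH (S k) ltac:(lia) ltac:(lia)).
      specialize (R2 k ltac:(lia)). lra. }
  assert (Hord : forall i, (i < m)%nat -> 0 <= radius0 r i < radius0 r (S i) /\ radius0 r (S i) <= 1).
  { intros i Hi. assert (K := Hup (m - S i)%nat (S i) ltac:(lia) ltac:(lia)).
    split; [|exact K]. destruct i as [|i]; simpl; [lra|].
    specialize (Hpos (S i) ltac:(lia)). specialize (R2 (S i) ltac:(lia)). lra. }
  assert (Hreg : forall i s, (i < m)%nat -> radius0 r i < s < radius0 r (S i) -> nodal_region N r i (axis s)).
  { intros i s Hi Hs. apply nodal_region_intro. rewrite norm_axis by lia.
    rewrite Rabs_pos_eq by (specialize (Hord i Hi); lra). exact Hs. }
  split; [exact Hord|split].
  - intros i Hi. destruct (Req_dec (u (axis (radius0 r i))) 0) as [|Hne]; [assumption|exfalso].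
    destruct (R4 i ltac:(lia)) as (_ & C2 & C3 & C4).
    set (x0 := axis (radius0 r i)) in *.
    assert (Hri := Hord i ltac:(lia)).
    assert (Hnx0 : norm N x0 = radius0 r i).
    { unfold x0. rewrite norm_axis, Rabs_pos_eq by (lia || lra). reflexivity. }
    assert (K : nodal_region N r i x0).
    { apply (C4 (fun x => nodal_region N r i x \/ x = x0)); [|tauto| |right; reflexivity].
      - apply connected_add_limit_point; [assumption|]. intros eps He.
        set (s := Rmin ((radius0 r i + radius0 r (S i)) / 2) (radius0 r i + eps / 2)).
        assert (Hs : radius0 r i < s < radius0 r (S i) /\ s < radius0 r i + eps)
          by (unfold s, Rmin; destruct Rle_dec; lra).
        exists (axis s). split; [apply Hreg; [lia|lra]|].
        unfold x0. rewrite dist_axis, Rabs_pos_eq by (lia || lra). lra.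
      - intros x [Hx| ->]; [auto|]. split; [|assumption].
        unfold ballB. rewrite Hnx0. lra. }
    destruct K as [[K _]|[_ K]]; [lia|]. rewrite Hnx0 in K. destruct i; [lia|]. simpl in K. lra.
  - intros i s Hi Hs. destruct (R4 i Hi) as (_ & C2 & _). apply C2, Hreg; assumption.
Qed.

(** * The bubble and continuous dependence *)

(** U is a power of X, and X' is a constant multiple of s X^2, so all derivatives of U are
    combinations of powers of X. *)
Definition bubX (n s : R) : R := n * (n - 2) / (n * (n - 2) + s ^ 2).
Definition bub (n s : R) : R := Rpower (bubX n s) ((n - 2) / 2).
Definition bub1 (n s : R) : R := - (s / n) * Rpower (bubX n s) (n / 2).
Definition bub2 (n s : R) : R :=
  - (1 / n) * Rpower (bubX n s) (n / 2) + s ^ 2 / (n * (n - 2)) * Rpower (bubX n s) (n / 2 + 1).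

Lemma bubX_range (n s : R) : 3 <= n -> 0 < bubX n s <= 1.
Proof.
  intros Hn. unfold bubX. assert (0 < n * (n - 2)) by nra. pose proof (pow2_ge_0 s).
  split; [apply Rdiv_lt_0_compat; lra|]. apply Rle_div_l; lra.
Qed.

Lemma bubX_derive (n s : R) : 3 <= n ->
  is_derive (bubX n) s (- (2 * s * bubX n s ^ 2) / (n * (n - 2))).
Proof.
  intros Hn. unfold bubX. assert (0 < n * (n - 2)) by nra. pose proof (pow2_ge_0 s).
  simpl in *. auto_derive; [lra|]. field. split; [lra|]. split; lra.
Qed.

Lemma bubX_Rpower_derive (n s k : R) : 3 <= n ->
  is_derive (fun t => Rpower (bubX n t) k) s
    (- (2 * s / (n * (n - 2))) * (k * Rpower (bubX n s) (k + 1))).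
Proof.
  intros Hn. assert (HX := bubX_range n s Hn). assert (0 < n * (n - 2)) by nra.
  assert (K := is_derive_comp (fun t => Rpower t k) (bubX n) s _ _
    (is_derive_Rpower (bubX n s) k (proj1 HX)) (bubX_derive n s Hn)).
  match type of K with is_derive _ _ ?l => match goal with |- is_derive _ _ ?l' =>
    replace l' with l; [exact K|] end end.
  unfold scal; simpl; unfold mult; simpl.
  rewrite Rpower_plus, Rpower_1 by lra. field. repeat split; lra.
Qed.

Lemma bub_derive (n s : R) : 3 <= n -> is_derive (bub n) s (bub1 n s).
Proof.
  intros Hn. assert (K := bubX_Rpower_derive n s ((n - 2) / 2) Hn).
  unfold bub. replace (bub1 n s) with
    (- (2 * s / (n * (n - 2))) * ((n - 2) / 2 * Rpower (bubX n s) ((n - 2) / 2 + 1))); [exact K|].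
  unfold bub1. replace ((n - 2) / 2 + 1) with (n / 2) by field. field. lra.
Qed.

Lemma bub1_derive (n s : R) : 3 <= n -> is_derive (bub1 n) s (bub2 n s).
Proof.
  intros Hn. assert (K := bubX_Rpower_derive n s (n / 2) Hn).
  set (P := fun t => Rpower (bubX n t) (n / 2)) in K.
  change (is_derive (fun t => - (t / n) * P t) s (bub2 n s)). auto_derive.
  - eexists; exact K.
  - replace (Derive (fun x => P x) s) with
      (- (2 * s / (n * (n - 2))) * (n / 2 * Rpower (bubX n s) (n / 2 + 1)))
      by (symmetry; apply is_derive_unique, K).
    unfold bub2, P. field. lra.
Qed.

Lemma bub_ode (n s : R) : 3 <= n -> 0 < s ->
  bub2 n s = - (n - 1) / s * bub1 n s - Rpower (bub n s) ((n + 2) / (n - 2)).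
Proof.
  intros Hn Hs. assert (HX := bubX_range n s Hn).
  unfold bub. rewrite Rpower_mult.
  replace ((n - 2) / 2 * ((n + 2) / (n - 2))) with (n / 2 + 1) by (field; lra).
  unfold bub1, bub2. rewrite !Rpower_plus, Rpower_1 by lra.
  set (P := Rpower (bubX n s) (n / 2)). unfold bubX.
  assert (0 < n * (n - 2)) by nra. pose proof (pow2_ge_0 s).
  field. repeat split; simpl in *; lra.
Qed.

Lemma bub_range (n s : R) : 3 <= n -> 0 < bub n s <= 1.
Proof.
  intros Hn. split; [apply Rpower_pos|]. apply Rpower_le1; [apply bubX_range, Hn|lra].
Qed.

Lemma bub1_bound (n s : R) : 3 <= n -> 0 <= s -> - s <= bub1 n s <= 0.
Proof.
  intros Hn Hs. unfold bub1.
  assert (H1 := Rpower_le1 (bubX n s) (n / 2) (bubX_range n s Hn) ltac:(lra)).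
  assert (H2 := Rpower_pos (bubX n s) (n / 2)).
  assert (H3 : 0 <= s / n <= s).
  { split; [apply Rdiv_le_0_compat; lra|]. apply Rle_div_l; nra. }
  split; nra.
Qed.

Lemma bub_decr (n s t : R) : 3 <= n -> 0 <= s <= t -> bub n t <= bub n s.
Proof.
  intros Hn Hst. apply Ropp_le_cancel.
  apply (derive_nonneg_le (fun x => - bub n x) (fun x => - bub1 n x)); [lra| |].
  - intros x Hx. apply (is_derive_opp (bub n)), bub_derive, Hn.
  - intros x Hx. pose proof (bub1_bound n x Hn). lra.
Qed.

Lemma bub_0 (n : R) : 3 <= n -> bub n 0 = 1.
Proof.
  intros Hn. unfold bub, bubX. replace (n * (n - 2) / (n * (n - 2) + 0 ^ 2)) with 1 by (field; nra).
  apply Rpower_1_l.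
Qed.

(** Together with [bub1_bound], this bounds by s the discrepancy between U at radius s and the data
    (1, 0) that the rescaled profile has at its peak. *)
Lemma bub_near0 (n s : R) : 3 <= n -> 0 <= s <= 1 -> 1 - s <= bub n s.
Proof.
  intros Hn Hs.
  assert (K : bub n 0 + 0 <= bub n s + s); [|rewrite bub_0 in K by assumption; lra].
  apply (derive_nonneg_le (fun x => bub n x + x) (fun x => bub1 n x + 1)); [lra| |].
  - intros x Hx. apply (is_derive_plus (bub n) (fun x => x)); [apply bub_derive, Hn|auto_derive; [trivial|reflexivity]].
  - intros x Hx. pose proof (bub1_bound n x Hn). lra.
Qed.

(** The derivative in the exponent is x^p ln x, and x |ln x| <= 1 on (0,1]; the bound is thus
    uniform even where the profile approaches 0. *)
Lemma Rpower_exponent_diff (x p q : R) : 0 < x <= 1 -> 1 <= p <= q ->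
  Rabs (Rpower x p - Rpower x q) <= q - p.
Proof.
  intros Hx Hpq. rewrite Rabs_pos_eq by (pose proof (Rpower_base_lt1 x p q Hx); lra).
  replace q with (p + (q - p)) at 1 by ring. rewrite Rpower_plus.
  assert (H1 : Rpower x p <= x) by (rewrite <- (Rpower_1 x) at 2 by lra; apply Rpower_base_lt1; lra).
  assert (H0 := Rpower_pos x p).
  assert (H2 : 1 + (q - p) * ln x <= Rpower x (q - p)) by apply exp_ineq1_le.
  assert (H3 : - ln x <= / x - 1).
  { rewrite <- ln_Rinv by lra. assert (K := exp_ineq1_le (ln (/ x))).
    rewrite exp_ln in K by (apply Rinv_0_lt_compat; lra). lra. }
  assert (H4 : x * - ln x <= 1).
  { apply Rle_trans with (x * (/ x - 1)); [apply Rmult_le_compat_l; lra|].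
    replace (x * (/ x - 1)) with (1 - x) by (field; lra). lra. }
  assert (H5 : 0 <= - ln x).
  { rewrite <- Ropp_0. apply Ropp_le_contravar. rewrite <- ln_1. destruct (proj2 Hx) as [K| ->]; [|lra].
    left; apply ln_increasing; lra. }
  assert (H6 : Rpower x p * - ln x <= 1) by nra.
  replace (Rpower x p - Rpower x p * Rpower x (q - p)) with (Rpower x p * (1 - Rpower x (q - p))) by ring.
  apply Rle_trans with (Rpower x p * ((q - p) * - ln x)); [apply Rmult_le_compat_l; lra|]. nra.
Qed.

(** On (0,1] the derivative q t^(q-1) is at most q, so q t - t^q is nondecreasing. *)
Lemma Rpower_base_diff (x y q : R) : 0 < x <= 1 -> 0 < y <= 1 -> 1 <= q ->
  Rabs (Rpower x q - Rpower y q) <= q * Rabs (x - y).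
Proof.
  assert (H : forall x y q, 0 < x <= 1 -> 0 < y <= 1 -> 1 <= q -> x <= y ->
     Rpower x q <= Rpower y q <= Rpower x q + q * (y - x)).
  { clear. intros x y q Hx Hy Hq Hxy. split; [apply Rle_Rpower_l; lra|].
    assert (K : q * x - Rpower x q <= q * y - Rpower y q); [|lra].
    apply (derive_nonneg_le (fun t => q * t - Rpower t q) (fun t => q - q * Rpower t q / t)); [assumption| |].
    - intros t Ht. apply (is_derive_minus (fun t => q * t) (fun t => Rpower t q)).
      + auto_derive; [trivial|ring].
      + apply is_derive_Rpower. lra.
    - intros t Ht. assert (Ht1 : Rpower t q <= t).
      { rewrite <- (Rpower_1 t) at 2 by lra. apply Rpower_base_lt1; lra. }
      assert (Rpower t q / t <= 1) by (apply Rle_div_l; lra).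
      unfold Rdiv in *. nra. }
  intros Hx Hy Hq. destruct (Rle_lt_dec x y) as [Hxy|Hxy].
  - destruct (H x y q Hx Hy Hq Hxy). rewrite !Rabs_left1 by lra. lra.
  - destruct (H y x q Hy Hx Hq ltac:(lra)). rewrite !Rabs_pos_eq by lra. lra.
Qed.

(* The friction term (n-1)/s has the right sign, so that it can be dropped in the
   Gronwall estimate, however small the initial radius [sg]. *)
Lemma gronwall_bubble (n q p sg L : R) (f f1 f2 : R -> R) :
  3 <= n -> q = (n + 2) / (n - 2) -> 1 <= p < q -> 0 <= sg <= 1 ->
  (forall s, sg <= s < L -> is_derive f s (f1 s)) ->
  (forall s, sg <= s < L -> is_derive f1 s (f2 s)) ->
  (forall s, sg < s < L -> f2 s = - (n - 1) / s * f1 s - Rpower (f s) p) ->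
  (forall s, sg <= s < L -> 0 < f s <= 1) -> f sg = 1 -> f1 sg = 0 ->
  forall s, sg <= s < L ->
    (f1 s - bub1 n s) ^ 2 + (f s - bub n s) ^ 2 <= (2 * sg ^ 2 + (q - p) ^ 2) * exp ((q + 2) * s).
Proof.
  intros Hn Hq Hp Hsg Hf Hf1 Hode Hran Hf0 Hf10 s Hs.
  set (d := fun t => f t - bub n t). set (d1 := fun t => f1 t - bub1 n t).
  set (d2 := fun t => f2 t - bub2 n t). set (h := q - p).
  (* Adding h^2 absorbs the forcing of size h caused by the two different exponents. The rate q + 2
     comes from 2 X (q Y + h) + 2 X Y <= q (X^2 + Y^2) + (X^2 + h^2) + (X^2 + Y^2). *)
  set (G := fun t => (d1 t ^ 2 + d t ^ 2 + h ^ 2) * exp (- (q + 2) * t)).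
  assert (Hd : forall t, sg <= t < L -> is_derive d t (d1 t)).
  { intros t Ht. apply (is_derive_minus f (bub n)); [apply Hf, Ht|apply bub_derive, Hn]. }
  assert (Hd1 : forall t, sg <= t < L -> is_derive d1 t (d2 t)).
  { intros t Ht. apply (is_derive_minus f1 (bub1 n)); [apply Hf1, Ht|apply bub1_derive, Hn]. }
  assert (K : G s <= G sg).
  { apply Ropp_le_cancel.
    apply (derive_nonneg_le (fun t => - G t)
      (fun t => - ((2 * d1 t * d2 t + 2 * d t * d1 t - (q + 2) * (d1 t ^ 2 + d t ^ 2 + h ^ 2)) * exp (- (q + 2) * t)))); [lra| |].
    - intros t Ht. assert (E1 := Hd t ltac:(lra)). assert (E2 := Hd1 t ltac:(lra)).
      apply (is_derive_opp G). unfold G. auto_derive.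
      + repeat split; eexists; eassumption.
      + replace (Derive (fun x => d x) t) with (d1 t) by (symmetry; apply is_derive_unique, E1).
        replace (Derive (fun x => d1 x) t) with (d2 t) by (symmetry; apply is_derive_unique, E2).
        ring.
    - intros t Ht. assert (Ht0 : 0 < t) by lra.
      set (F := Rpower (f t) p - Rpower (bub n t) q).
      assert (Ed2 : d2 t = - (n - 1) / t * d1 t - F).
      { unfold d2, F. rewrite Hode, bub_ode by lra. rewrite <- Hq. unfold d1. field. lra. }
      assert (HF : Rabs F <= q * Rabs (d t) + h).
      { unfold F. replace (Rpower (f t) p - Rpower (bub n t) q) with
          ((Rpower (f t) p - Rpower (f t) q) + (Rpower (f t) q - Rpower (bub n t) q)) by ring.
        eapply Rle_trans; [apply Rabs_triang|].
        assert (F1 := Rpower_exponent_diff (f t) p q (Hran t ltac:(lra)) ltac:(lra)).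
        assert (F2 := Rpower_base_diff (f t) (bub n t) q (Hran t ltac:(lra)) (bub_range n t Hn) ltac:(lra)).
        fold (d t) in F2. unfold h. lra. }
      assert (HdF : - (d1 t * F) <= Rabs (d1 t) * (q * Rabs (d t) + h)).
      { apply Rle_trans with (Rabs (d1 t * F)); [rewrite <- Rabs_Ropp; apply Rle_abs|].
        rewrite Rabs_mult. apply Rmult_le_compat_l; [apply Rabs_pos|assumption]. }
      assert (Hfr : d1 t * (- (n - 1) / t * d1 t) <= 0).
      { replace (d1 t * (- (n - 1) / t * d1 t)) with (- ((n - 1) * d1 t ^ 2 / t)) by (field; lra).
        assert (0 <= (n - 1) * d1 t ^ 2 / t); [|lra].
        apply Rdiv_le_0_compat; [|assumption]. pose proof (pow2_ge_0 (d1 t)). nra. }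
      assert (Hx := pow2_abs (d1 t)). assert (Hy := pow2_abs (d t)).
      assert (Hdd : d t * d1 t <= Rabs (d t) * Rabs (d1 t)) by (rewrite <- Rabs_mult; apply Rle_abs).
      assert (X0 := Rabs_pos (d1 t)). assert (Y0 := Rabs_pos (d t)).
      rewrite <- Hx, <- Hy, Ed2.
      set (X := Rabs (d1 t)) in *. set (Y := Rabs (d t)) in *.
      assert (Hh : 0 < h) by (unfold h; lra).
      assert (Q : 2 * d1 t * (- (n - 1) / t * d1 t - F) + 2 * d t * d1 t <= (q + 2) * (X ^ 2 + Y ^ 2 + h ^ 2)).
      { apply Rle_trans with (2 * (X * (q * Y + h)) + 2 * (Y * X)); [lra|].
        assert (2 * (X * Y) <= X ^ 2 + Y ^ 2) by (pose proof (pow2_ge_0 (X - Y)); lra).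
        assert (2 * (X * h) <= X ^ 2 + h ^ 2) by (pose proof (pow2_ge_0 (X - h)); lra).
        assert (q * (2 * (X * Y)) <= q * (X ^ 2 + Y ^ 2)) by (apply Rmult_le_compat_l; lra).
        pose proof (pow2_ge_0 Y). pose proof (pow2_ge_0 h). nra. }
      assert (E0 := exp_pos (- (q + 2) * t)). nra. }
  unfold G in K.
  assert (Hexp : exp (- (q + 2) * s) * exp ((q + 2) * s) = 1).
  { rewrite <- exp_plus. replace (- (q + 2) * s + (q + 2) * s) with 0 by ring. apply exp_0. }
  assert (Ep := exp_pos ((q + 2) * s)).
  apply (Rmult_le_compat_r (exp ((q + 2) * s))) in K; [|lra].
  rewrite Rmult_assoc, Hexp, Rmult_1_r in K.
  assert (G0 : d1 sg ^ 2 + d sg ^ 2 + h ^ 2 <= 2 * sg ^ 2 + h ^ 2).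
  { unfold d, d1. rewrite Hf0, Hf10.
    assert (B1 := bub1_bound n sg Hn ltac:(lra)). assert (B2 := bub_near0 n sg Hn Hsg).
    assert (B3 := bub_range n sg Hn). nra. }
  assert (G1 : exp (- (q + 2) * sg) <= 1).
  { rewrite <- exp_0. destruct (Rle_lt_or_eq_dec 0 sg ltac:(lra)) as [P|P].
    - left. apply exp_increasing. nra.
    - rewrite <- P. right. f_equal. ring. }
  fold (d s) (d1 s). fold h.
  assert (G2 : 0 <= d1 sg ^ 2 + d sg ^ 2 + h ^ 2)
    by (pose proof (pow2_ge_0 (d1 sg)); pose proof (pow2_ge_0 (d sg)); pose proof (pow2_ge_0 h); lra).
  apply Rle_trans with (d1 s ^ 2 + d s ^ 2 + h ^ 2); [pose proof (pow2_ge_0 h); lra|].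
  eapply Rle_trans; [exact K|]. apply Rmult_le_compat_r; [lra|].
  assert (E0 := exp_pos (- (q + 2) * sg)). nra.
Qed.

(** L is the rescaled next zero, not known to be large beforehand. Before L the profile takes
    arbitrarily small values; on [sg, Rm] it stays close to U, which is at least U(Rm) > 0, so L
    lies beyond Rm. *)
Lemma rescaled_convergence (n q Rm eps : R) :
  3 <= n -> q = (n + 2) / (n - 2) -> 0 < Rm -> 0 < eps ->
  exists eta, 0 < eta /\ forall (p sg L : R) (f f1 f2 : R -> R),
  1 <= p -> q - eta < p < q -> 0 <= sg < eta ->
  (forall s, sg <= s < L -> is_derive f s (f1 s)) ->
  (forall s, sg <= s < L -> is_derive f1 s (f2 s)) ->
  (forall s, sg < s < L -> f2 s = - (n - 1) / s * f1 s - Rpower (f s) p) ->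
  (forall s, sg <= s < L -> 0 < f s <= 1) -> f sg = 1 -> f1 sg = 0 ->
  (forall e, 0 < e -> exists s, sg <= s < L /\ f s < e) ->
  Rm < L /\ forall s, sg <= s <= Rm ->
    Rabs (f s - bub n s) <= eps /\ Rabs (f1 s - bub1 n s) <= eps /\
    Rabs (Rpower (f s) p - Rpower (bub n s) q) <= eps.
Proof.
  intros Hn Hq HRm He.
  assert (Hq1 : 1 < q) by (rewrite Hq; apply (Rlt_div_r 1); lra).
  (* The first bound leaves room for the nonlinearity, whose error is at most (q - p) + q e1; the
     second one keeps the profile above U(Rm) / 2. *)
  set (e1 := Rmin (eps / (q + 1)) (bub n Rm / 2)).
  assert (HUm := bub_range n Rm Hn).
  assert (He1 : 0 < e1) by (apply Rmin_pos; [apply Rdiv_lt_0_compat; lra|lra]).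
  assert (He1a : (q + 1) * e1 <= eps).
  { assert (K : e1 <= eps / (q + 1)) by apply Rmin_l.
    apply (Rmult_le_compat_l (q + 1)) in K; [|lra].
    replace ((q + 1) * (eps / (q + 1))) with eps in K by (field; lra). exact K. }
  assert (He1b : e1 <= bub n Rm / 2) by apply Rmin_r.
  set (Lam := exp ((q + 2) * Rm)).
  assert (HLam : 1 <= Lam) by (pose proof (exp_ineq1_le ((q + 2) * Rm)); unfold Lam; nra).
  (* The squared Gronwall error is at most 3 eta^2 Lam, which is below (2 Lam eta)^2 <= e1^2 because
     Lam >= 1. *)
  set (eta := Rmin 1 (e1 / (2 * Lam))).
  assert (Heta : 0 < eta) by (apply Rmin_pos; [lra|apply Rdiv_lt_0_compat; lra]).
  assert (Heta1 : eta <= 1) by apply Rmin_l.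
  assert (Heta2 : 2 * (Lam * eta) <= e1).
  { assert (K : eta <= e1 / (2 * Lam)) by apply Rmin_r.
    apply (Rmult_le_compat_l (2 * Lam)) in K; [|lra].
    replace (2 * Lam * (e1 / (2 * Lam))) with e1 in K by (field; lra). lra. }
  exists eta. split; [assumption|].
  intros p sg L f f1 f2 Hp Hpq Hsg Hf Hf1 Hode Hran Hf0 Hf10 Hzero.
  assert (Hest : forall s, sg <= s < L -> s <= Rm ->
     Rabs (f s - bub n s) <= e1 /\ Rabs (f1 s - bub1 n s) <= e1).
  { intros s Hs HsR.
    assert (K := gronwall_bubble n q p sg L f f1 f2 Hn Hq ltac:(lra) ltac:(lra) Hf Hf1 Hode Hran Hf0 Hf10 s Hs).
    assert (KL : exp ((q + 2) * s) <= Lam).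
    { unfold Lam. destruct (Req_dec s Rm) as [->|Hne]; [lra|]. left. apply exp_increasing. nra. }
    assert (K0 := exp_pos ((q + 2) * s)).
    assert (K1 : 2 * sg ^ 2 + (q - p) ^ 2 <= 3 * eta ^ 2) by nra.
    assert (K2 : (2 * sg ^ 2 + (q - p) ^ 2) * exp ((q + 2) * s) <= 3 * eta ^ 2 * Lam).
    { apply Rmult_le_compat; try lra. pose proof (pow2_ge_0 sg). pose proof (pow2_ge_0 (q - p)). lra. }
    assert (K3 : 3 * eta ^ 2 * Lam <= e1 ^ 2).
    { assert (L1 : (2 * (Lam * eta)) * (2 * (Lam * eta)) <= e1 * e1) by (apply Rmult_le_compat; nra).
      assert (L2 : eta ^ 2 * Lam <= eta ^ 2 * (Lam * Lam)).
      { apply Rmult_le_compat_l; [apply pow2_ge_0|nra]. }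
      pose proof (pow2_ge_0 eta). nra. }
    pose proof (pow2_ge_0 (f s - bub n s)). pose proof (pow2_ge_0 (f1 s - bub1 n s)).
    split; apply Rabs_le; split; nra. }
  assert (HL : Rm < L).
  { apply Rnot_le_lt. intros HLR.
    destruct (Hzero (bub n Rm / 2) ltac:(lra)) as [s [Hs Hfs]].
    destruct (Hest s Hs ltac:(lra)) as [K _]. apply Rabs_le_between in K.
    assert (K2 := bub_decr n s Rm Hn ltac:(lra)). lra. }
  split; [assumption|].
  intros s Hs. destruct (Hest s ltac:(lra) ltac:(lra)) as [K1 K2].
  assert (e1 <= eps) by nra.
  split; [lra|split; [lra|]].
  replace (Rpower (f s) p - Rpower (bub n s) q) with
    ((Rpower (f s) p - Rpower (f s) q) + (Rpower (f s) q - Rpower (bub n s) q)) by ring.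
  eapply Rle_trans; [apply Rabs_triang|].
  assert (F1 := Rpower_exponent_diff (f s) p q (Hran s ltac:(lra)) ltac:(lra)).
  assert (F2 := Rpower_base_diff (f s) (bub n s) q (Hran s ltac:(lra)) (bub_range n s Hn) ltac:(lra)).
  assert (eta <= e1) by nra. nra.
Qed.

(** * Partial derivatives of radial functions *)

Lemma norm_upd_derive (N k : nat) (x : pt) : (k < N)%nat -> 0 < norm N x ->
  is_derive (fun t => norm N (upd x k t)) (x k) (x k / norm N x).
Proof.
  intros Hk Hx.
  apply (is_derive_ext (fun t => sqrt (norm N x ^ 2 - x k ^ 2 + t ^ 2))).
  { intros t. symmetry. apply norm_upd, Hk. }
  assert (H0 : norm N x ^ 2 - x k ^ 2 + x k ^ 2 = norm N x ^ 2) by ring.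
  assert (Hs : sqrt (norm N x ^ 2) = norm N x) by (apply sqrt_pow2; lra).
  assert (Hp : 0 < norm N x ^ 2) by (apply pow_lt, Hx).
  set (c := norm N x ^ 2 - x k ^ 2) in *.
  auto_derive.
  - simpl in H0. rewrite H0. exact Hp.
  - replace (c + x k * (x k * 1)) with (norm N x ^ 2) by (rewrite <- H0; ring).
    rewrite Hs. field. lra.
Qed.

Lemma upd_coord (x : pt) (j k : nat) (t : R) : upd x j t k = if Nat.eqb k j then t else x k.
Proof. reflexivity. Qed.

Lemma norm_upd_zero (N k : nat) (x : pt) (t : R) : (k < N)%nat -> norm N x = 0 ->
  norm N (upd x k t) = Rabs t.
Proof.
  intros Hk Hx. assert (Hc := norm_coord N k x Hk). rewrite Hx in Hc.
  assert (Hxk : x k = 0) by (apply Rabs_eq_0; pose proof (Rabs_pos (x k)); lra).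
  rewrite norm_upd, Hx, Hxk by assumption. rewrite <- sqrt_Rsqr_abs. f_equal. unfold Rsqr. ring.
Qed.

(** If h is the profile of a radial function, its gradient is Q(|x|) x with this coefficient Q; the
    value at 0 is the limit of h'(s)/s when h'(0) = 0. *)
Definition radial_quot (h1 h2 : R -> R) (s : R) : R := if Req_EM_T s 0 then h2 0 else h1 s / s.

Lemma radial_quot_pos (h1 h2 : R -> R) (s : R) : s <> 0 -> radial_quot h1 h2 s = h1 s / s.
Proof. intros H. unfold radial_quot. destruct Req_EM_T; [contradiction|reflexivity]. Qed.

Lemma radial_quot_lim0 (h1 h2 : R -> R) (eps : R) :
  is_derive h1 0 (h2 0) -> h1 0 = 0 -> 0 < eps ->
  exists d, 0 < d /\ forall s, Rabs s < d -> Rabs (radial_quot h1 h2 s - h2 0) <= eps.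
Proof.
  intros Hd H0 He. destruct (is_derive_eps h1 0 (h2 0) eps Hd He) as [d [Hd0 K]].
  exists d. split; [assumption|]. intros s Hs. unfold radial_quot.
  destruct Req_EM_T as [_|Hne]; [rewrite Rminus_diag, Rabs_R0; lra|].
  specialize (K s). rewrite Rminus_0_r, H0, Rminus_0_r in K. specialize (K Hs).
  replace (h1 s / s - h2 0) with ((h1 s - h2 0 * s) / s) by (field; assumption).
  assert (Hs0 : 0 < Rabs s) by (apply Rabs_pos_lt, Hne).
  unfold Rdiv. rewrite Rabs_mult, Rabs_inv. apply Rle_div_l; assumption.
Qed.

(** The condition [al < 0] signals that the origin belongs to the region, so balls and annuli are
    handled together. At the origin the norm along a coordinate line is |t|, and h (|t|) is
    differentiable there because h'(0) = 0. *)
Lemma radial_partial (N : nat) (F : pt -> R) (h h1 h2 : R -> R) (al be : R) :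
  (forall x, F x = h (norm N x)) ->
  (forall s, al < s < be -> is_derive h s (h1 s)) -> (al < 0 -> h1 0 = 0) ->
  forall x k, al < norm N x < be -> (k < N)%nat ->
  partial_at F k x (radial_quot h1 h2 (norm N x) * x k).
Proof.
  intros HF Hh Hh0 x k Hx Hk. unfold partial_at. apply is_derive_Reals.
  apply (is_derive_ext (fun t => h (norm N (upd x k t)))); [intros; symmetry; apply HF|].
  destruct (Rle_lt_or_eq_dec 0 (norm N x) (norm_nonneg N x)) as [Hpos|Hz].
  - rewrite radial_quot_pos by lra.
    assert (K : is_derive h (norm N (upd x k (x k))) (h1 (norm N x))) by (rewrite upd_self; apply Hh, Hx).
    assert (L := is_derive_comp h (fun t => norm N (upd x k t)) (x k) _ _ K (norm_upd_derive N k x Hk Hpos)).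
    replace (h1 (norm N x) / norm N x * x k) with (scal (x k / norm N x) (h1 (norm N x))); [exact L|].
    unfold scal; simpl; unfold mult; simpl. field. lra.
  - symmetry in Hz. assert (Hc := norm_coord N k x Hk). rewrite Hz in Hc.
    assert (Hxk : x k = 0) by (apply Rabs_eq_0; pose proof (Rabs_pos (x k)); lra).
    rewrite Hxk, Rmult_0_r. apply (is_derive_ext (fun t => h (Rabs t))).
    { intros t. rewrite norm_upd_zero by assumption. reflexivity. }
    rewrite Hz in Hx. assert (K := Hh 0 Hx). rewrite Hh0 in K by lra.
    apply is_derive_Reals. intros eps He.
    destruct (is_derive_eps h 0 0 (eps / 2) K ltac:(lra)) as [d [Hd L]].
    exists (mkposreal d Hd). simpl. intros t Ht0 Ht.
    specialize (L (Rabs t)). rewrite Rminus_0_r, Rabs_Rabsolu, Rmult_0_l, Rminus_0_r in L.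
    specialize (L Ht). rewrite Rplus_0_l, Rabs_R0, Rminus_0_r.
    assert (Ht1 : 0 < Rabs t) by (apply Rabs_pos_lt, Ht0).
    unfold Rdiv at 1. rewrite Rabs_mult, Rabs_inv.
    apply Rle_lt_trans with (eps / 2); [|lra]. apply Rle_div_l; assumption.
Qed.

(** Away from the origin the Hessian entry is (x_j x_k / rho^2) (h'' - Q) plus Q on the diagonal,
    with |x_j|, |x_k| <= rho. At the origin it is h''(0) on the diagonal and 0 elsewhere. *)
Lemma radial_partial2 (N : nat) (F : pt -> R) (h h1 h2 : R -> R) (al be : R) :
  (forall x, F x = h (norm N x)) ->
  (forall s, al < s < be -> is_derive h s (h1 s)) ->
  (forall s, al < s < be -> is_derive h1 s (h2 s)) -> (al < 0 -> h1 0 = 0) ->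
  forall x k j, al < norm N x < be -> (k < N)%nat -> (j < N)%nat ->
  exists l, partial2_at N F k j x l /\
    Rabs l <= Rabs (h2 (norm N x)) + 2 * Rabs (radial_quot h1 h2 (norm N x)).
Proof.
  intros HF Hh Hh1 Hh0 x k j Hx Hk Hj.
  set (Q := radial_quot h1 h2).
  assert (Hmain : exists l, partial_at (fun y => Q (norm N y) * y k) j x l /\
    Rabs l <= Rabs (h2 (norm N x)) + 2 * Rabs (Q (norm N x))).
  2:{ destruct Hmain as [l [Hl1 Hl2]]. exists l. split; [|exact Hl2].
      exists (fun y => Q (norm N y) * y k), (Rmin (norm N x - al) (be - norm N x)).
      split; [apply Rmin_pos; lra|split; [|exact Hl1]].
      intros y Hy. apply (radial_partial N F h h1 h2 al be); auto.
      assert (K := norm_dist N x y). apply Rabs_le_between in K.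
      assert (K1 := Rmin_l (norm N x - al) (be - norm N x)).
      assert (K2 := Rmin_r (norm N x - al) (be - norm N x)). lra. }
  assert (Hck := norm_coord N k x Hk). assert (Hcj := norm_coord N j x Hj).
  destruct (Rle_lt_or_eq_dec 0 (norm N x) (norm_nonneg N x)) as [Hpos|Hz].
  - set (rho := norm N x) in *.
    set (dl := if Nat.eqb k j then 1 else 0).
    set (Q1 := (h2 rho - h1 rho / rho) / rho).
    assert (HQ : is_derive Q rho Q1).
    { apply (is_derive_ext_loc (fun s => h1 s / s)).
      - exists (mkposreal rho Hpos). intros s Hs. symmetry. apply radial_quot_pos.
        apply Rabs_lt_between' in Hs. simpl in Hs. lra.
      - assert (K := Hh1 rho Hx). auto_derive.
        + split; [eexists; exact K|split; [lra|trivial]].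
        + replace (Derive (fun x => h1 x) rho) with (h2 rho) by (symmetry; apply is_derive_unique, K).
          unfold Q1. field. lra. }
    exists (x j / rho * Q1 * x k + Q rho * dl). split.
    + unfold partial_at. apply is_derive_Reals.
      assert (K : is_derive Q (norm N (upd x j (x j))) Q1) by (rewrite upd_self; exact HQ).
      assert (L := is_derive_comp Q (fun t => norm N (upd x j t)) (x j) _ _ K (norm_upd_derive N j x Hj Hpos)).
      assert (L2 : is_derive (fun t => upd x j t k) (x j) dl).
      { unfold dl, upd. destruct (Nat.eqb k j); auto_derive; trivial; ring. }
      assert (L3 := is_derive_mult _ _ _ _ _ L L2 Rmult_comm).
      match type of L3 with is_derive _ _ ?l => match goal with |- is_derive _ _ ?l' =>
        replace l' with l; [exact L3|] end end.
      rewrite upd_self. reflexivity.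
    + assert (HQr : Q rho = h1 rho / rho) by (apply radial_quot_pos; lra).
      assert (E1 : x j / rho * Q1 * x k = (x j / rho) * (x k / rho) * (h2 rho - Q rho)).
      { rewrite HQr. unfold Q1. field. lra. }
      assert (B : forall t, Rabs t <= rho -> Rabs (t / rho) <= 1).
      { intros t Ht. unfold Rdiv. rewrite Rabs_mult, Rabs_inv, (Rabs_pos_eq rho) by lra.
        apply Rle_div_l; lra. }
      assert (Bj := B _ Hcj). assert (Bk := B _ Hck).
      rewrite E1. eapply Rle_trans; [apply Rabs_triang|].
      assert (T1 : Rabs (x j / rho * (x k / rho) * (h2 rho - Q rho)) <= Rabs (h2 rho) + Rabs (Q rho)).
      { rewrite Rabs_mult. apply Rle_trans with (1 * Rabs (h2 rho - Q rho)).
        - apply Rmult_le_compat_r; [apply Rabs_pos|]. rewrite Rabs_mult.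
          rewrite <- (Rmult_1_l 1). apply Rmult_le_compat; auto using Rabs_pos.
        - rewrite Rmult_1_l. eapply Rle_trans; [apply Rabs_triang|]. rewrite Rabs_Ropp. lra. }
      assert (T2 : Rabs (Q rho * dl) <= Rabs (Q rho)).
      { rewrite Rabs_mult. pose proof (Rabs_pos (Q rho)). unfold dl.
        destruct (Nat.eqb k j); [rewrite Rabs_R1|rewrite Rabs_R0]; lra. }
      lra.
  - symmetry in Hz. rewrite Hz in *.
    assert (Hxj : x j = 0) by (apply Rabs_eq_0; pose proof (Rabs_pos (x j)); lra).
    assert (Hxk : x k = 0) by (apply Rabs_eq_0; pose proof (Rabs_pos (x k)); lra).
    assert (HQ0 : Q 0 = h2 0) by (unfold Q, radial_quot; destruct Req_EM_T; lra).
    pose proof (Rabs_pos (h2 0)).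
    unfold partial_at. rewrite Hxj.
    destruct (Nat.eqb k j) eqn:Ekj.
    + exists (h2 0). split; [|rewrite HQ0; lra].
      intros eps He.
      destruct (radial_quot_lim0 h1 h2 (eps / 2) (Hh1 0 Hx) (Hh0 (proj1 Hx)) ltac:(lra)) as [d [Hd K]].
      exists (mkposreal d Hd). simpl. intros t Ht0 Ht.
      rewrite !upd_coord, Ekj, Rplus_0_l, Rmult_0_r, !norm_upd_zero by assumption.
      replace ((Q (Rabs t) * t - 0) / t - h2 0) with (Q (Rabs t) - h2 0) by (field; assumption).
      apply Rle_lt_trans with (eps / 2); [|lra]. apply K. rewrite Rabs_Rabsolu. exact Ht.
    + exists 0. split; [|rewrite Rabs_R0; pose proof (Rabs_pos (Q 0)); lra].
      apply is_derive_Reals. apply (is_derive_ext (fun _ => 0)); [|auto_derive; trivial].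
      intros t. rewrite upd_coord, Ekj, Hxk. simpl. ring.
Qed.

(* s^(N-1) w1 is nonincreasing and vanishes at 0. *)
Lemma flux_nonpos (N : nat) (w1 w2 : R -> R) (b : R) : (2 <= N)%nat ->
  (forall s, 0 <= s < b -> is_derive w1 s (w2 s)) ->
  (forall s, 0 < s < b -> w2 s + (INR N - 1) / s * w1 s <= 0) ->
  forall s, 0 < s < b -> w1 s <= 0.
Proof.
  intros HN Hd Hle s Hs. destruct N as [|[|K]]; [lia|lia|].
  replace (INR (S (S K)) - 1) with (INR (S K)) in Hle by (rewrite (S_INR (S K)); ring).
  assert (H : s ^ S K * w1 s <= 0 ^ S K * w1 0).
  { apply Ropp_le_cancel.
    apply (derive_nonneg_le (fun t => - (t ^ S K * w1 t))
      (fun t => - (INR (S K) * t ^ K * w1 t + t ^ S K * w2 t))); [lra| |].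
    - intros t Ht. assert (E := Hd t ltac:(lra)).
      apply (is_derive_opp (fun t => t ^ S K * w1 t)).
      assert (P : is_derive (fun t => t ^ S K) t (INR (S K) * t ^ K)).
      { apply is_derive_Reals. apply derivable_pt_lim_pow. }
      exact (is_derive_mult _ _ _ _ _ P E Rmult_comm).
    - intros t Ht. assert (E := Hle t ltac:(lra)).
      assert (Hpow : 0 < t ^ S K) by (apply pow_lt; lra).
      replace (- (INR (S K) * t ^ K * w1 t + t ^ S K * w2 t)) with
        (t ^ S K * - (w2 t + INR (S K) / t * w1 t)).
      + apply Rmult_le_pos; lra.
      + simpl pow. field. lra. }
  rewrite pow_i, Rmult_0_l in H by lia.
  assert (Hpow : 0 < s ^ S K) by (apply pow_lt; lra).
  apply Rnot_lt_le. intros C. nra.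
Qed.

(** Comparison of w1 and - w1 with e s through [flux_nonpos]. The factor s is the point: it bounds
    w1 / s up to the origin, which a Gronwall estimate does not. *)
Lemma flux_bound (N : nat) (w1 w2 F : R -> R) (b e : R) : (2 <= N)%nat -> 0 <= e ->
  (forall s, 0 <= s < b -> is_derive w1 s (w2 s)) ->
  (forall s, 0 < s < b -> w2 s = - (INR N - 1) / s * w1 s - F s) ->
  (forall s, 0 < s < b -> Rabs (F s) <= e) ->
  forall s, 0 < s < b -> Rabs (w1 s) <= e * s.
Proof.
  intros HN He Hd Hode HF s Hs.
  assert (HN' : 2 <= INR N) by (apply (le_INR 2) in HN; simpl in HN; lra).
  assert (A : forall c, c = 1 \/ c = -1 -> c * w1 s - e * s <= 0).
  { intros c Hc.
    apply (flux_nonpos N (fun t => c * w1 t - e * t) (fun t => c * w2 t - e) b HN); [| |exact Hs].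
    - intros t Ht. apply (is_derive_minus (fun t => c * w1 t) (fun t => e * t)).
      + apply (is_derive_scal w1), Hd, Ht.
      + auto_derive; [trivial|ring].
    - intros t Ht. rewrite Hode by assumption. assert (HFt := HF t Ht). apply Rabs_le_between in HFt.
      replace (c * (- (INR N - 1) / t * w1 t - F t) - e + (INR N - 1) / t * (c * w1 t - e * t))
        with (- (c * F t) - INR N * e) by (field; lra).
      destruct Hc as [->| ->]; nra. }
  assert (A1 := A 1 (or_introl eq_refl)). assert (A2 := A (-1) (or_intror eq_refl)).
  apply Rabs_le. lra.
Qed.

(** * Convergence *)

Lemma interior_max_derive (f : R -> R) (a b s l : R) :
  a < s < b -> is_derive f s l -> (forall t, a < t < b -> f t <= f s) -> l = 0.
Proof.
  intros Hs Hd Hmax.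
  destruct (Rtotal_order l 0) as [H|[H|H]]; [exfalso|assumption|exfalso].
  - destruct (derive_neg_crossing (fun t => f t - f s) s l) as [d [Hd0 [_ K]]]; [|ring|assumption|].
    + auto_derive; [eexists; exact Hd|]. rewrite Rmult_1_l. apply is_derive_unique, Hd.
    + set (t := Rmax ((a + s) / 2) (s - d / 2)).
      assert (Ht : a < t < s /\ s - d < t) by (unfold t, Rmax; destruct Rle_dec; lra).
      specialize (K t ltac:(lra)). specialize (Hmax t ltac:(lra)). lra.
  - destruct (derive_neg_crossing (fun t => f s - f t) s (- l)) as [d [Hd0 [K _]]]; [|ring|lra|].
    + auto_derive; [eexists; exact Hd|].
      replace (Derive (fun x => f x) s) with l by (symmetry; apply is_derive_unique, Hd). ring.
    + set (t := Rmin ((s + b) / 2) (s + d / 2)).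
      assert (Ht : s < t < b /\ t < s + d) by (unfold t, Rmin; destruct Rle_dec; lra).
      specialize (K t ltac:(lra)). specialize (Hmax t ltac:(lra)). lra.
Qed.

Lemma radial_axis (N : nat) (u : pt -> R) (x : pt) : (0 < N)%nat -> radial N u ->
  u x = u (axis (norm N x)).
Proof.
  intros HN Hrad. apply Hrad. rewrite norm_axis, Rabs_pos_eq by (try assumption; apply norm_nonneg). reflexivity.
Qed.

(** For i = 0 the flux makes v nonincreasing, so the maximum is attained exactly at the origin,
    where v' = 0 by symmetry. For i > 0 the nodal interval is open and the maximum is interior. In
    both cases the signed profile leaves s with slope zero and stays in (0, Mi] up to the next
    zero. *)
Lemma nodal_peak (N i : nat) (p Mi : R) (u : pt -> R) (r : nat -> R) (v1 v2 : R -> R) :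
  (3 <= N)%nat -> is_profile (INR N) p (fun t => u (axis t)) v1 v2 -> radial N u -> 0 < u origin ->
  0 <= radius0 r i < r (S i) -> r (S i) <= 1 ->
  (forall s, radius0 r i < s < r (S i) -> 0 < (-1) ^ i * u (axis s)) ->
  is_max_abs u (nodal_region N r i) Mi ->
  exists s, radius0 r i <= s < r (S i) /\ ((0 < i)%nat -> radius0 r i < s) /\ (i = O -> s = 0) /\
    (-1) ^ i * u (axis s) = Mi /\ v1 s = 0 /\
    forall t, s <= t < r (S i) -> 0 < (-1) ^ i * u (axis t) <= Mi.
Proof.
  intros HN (H1 & H2 & H3 & H4) Hrad Hu0 Hr Hr1 Hpos [[x0 [Hx0 HM]] Hmax].
  set (v := fun t => u (axis t)) in *. set (c := (-1) ^ i) in *.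
  assert (Hc : c = 1 \/ c = -1) by apply pow_m1_cases.
  assert (Habs : forall t, 0 < c * v t -> Rabs (v t) = c * v t).
  { intros t Ht. destruct Hc as [E|E]; rewrite E in *; [rewrite Rabs_pos_eq|rewrite Rabs_left]; lra. }
  assert (Hv0 : 0 < v 0).
  { unfold v. replace (u (axis 0)) with (u origin); [assumption|]. apply Hrad.
    rewrite norm_origin, norm_axis, Rabs_R0 by lia. reflexivity. }
  assert (Hle : forall t, radius0 r i < t < r (S i) -> c * v t <= Mi).
  { intros t Ht. rewrite <- Habs by (apply Hpos, Ht). apply Hmax, nodal_region_intro.
    rewrite norm_axis, Rabs_pos_eq by (lia || lra). exact Ht. }
  rewrite (radial_axis N u x0 ltac:(lia) Hrad) in HM. fold (v (norm N x0)) in HM.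
  destruct i as [|i].
  - simpl in Hr, Hpos, Hle. assert (Ec : c = 1) by reflexivity. rewrite Ec in *.
    assert (Hx0' := nodal_region_radius N 0 r x0 Hx0). simpl in Hx0'.
    assert (Hvp : forall t, 0 <= t < r 1%nat -> 0 < v t).
    { intros t Ht. destruct (Req_dec t 0) as [->|Hne]; [assumption|].
      specialize (Hpos t ltac:(lra)). fold (v t) in Hpos. lra. }
    assert (Hv1 : forall t, 0 < t < r 1%nat -> v1 t <= 0).
    { apply (flux_nonpos N v1 v2); [lia| |].
      - intros t Ht. apply H2. lra.
      - intros t Ht. rewrite H4 by lra. rewrite spow_pos by (apply Hvp; lra).
        pose proof (Rpower_pos (v t) p).
        unfold Rdiv. unfold v in *. lra. }
    assert (Hdec : forall t, 0 <= t < r 1%nat -> v t <= v 0).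
    { intros t Ht. apply Ropp_le_cancel.
      apply (derive_nonneg_le (fun t => - v t) (fun t => - v1 t)); [lra| |].
      - intros x Hx. apply (is_derive_opp v), H1. lra.
      - intros x Hx. specialize (Hv1 x ltac:(lra)). lra. }
    assert (HM0 : v 0 = Mi).
    { apply Rle_antisym.
      - rewrite <- (Rabs_pos_eq (v 0)) by lra. apply Hmax. left. split; [reflexivity|].
        rewrite norm_axis, Rabs_R0 by lia. lra.
      - rewrite <- HM. rewrite Rabs_pos_eq by (left; apply Hvp; lra). apply Hdec. lra. }
    exists 0. simpl. split; [lra|]. split; [lia|]. split; [reflexivity|].
    split; [fold (v 0); lra|]. split; [assumption|].
    intros t Ht. fold (v t). rewrite Rmult_1_l, <- HM0. split; [apply Hvp|apply Hdec]; assumption.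
  - destruct Hx0 as [[E _]|[_ Hx0]]; [lia|].
    set (s := norm N x0) in *. simpl in Hr, Hpos, Hle. simpl radius0.
    assert (HMs : c * v s = Mi) by (rewrite <- HM; symmetry; apply Habs, Hpos, Hx0).
    exists s. split; [lra|]. split; [intros _; lra|]. split; [discriminate|]. split; [exact HMs|]. split.
    + assert (K : c * v1 s = 0).
      { apply (interior_max_derive (fun t => c * v t) (r (S i)) (r (S (S i))) s); [assumption| |].
        - apply (is_derive_scal v), H1. lra.
        - intros t Ht. rewrite HMs. apply Hle, Ht. }
      destruct Hc as [E|E]; rewrite E in K; lra.
    + intros t Ht. split; [apply Hpos|apply Hle]; lra.
Qed.

Lemma rescaled_profile (n p M : R) (v v1 v2 : R -> R) :
  is_profile n p v v1 v2 -> 0 < M ->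
  let l := Rpower M ((p - 1) / 2) in
  (forall s, - l < s < l -> is_derive (fun t => v (t / l) / M) s (v1 (s / l) / (M * l))) /\
  (forall s, - l < s < l -> is_derive (fun t => v1 (t / l) / (M * l)) s (v2 (s / l) / (M * l * l))) /\
  (forall s, 0 < s < l -> 0 < v (s / l) ->
     v2 (s / l) / (M * l * l) = - (n - 1) / s * (v1 (s / l) / (M * l)) - Rpower (v (s / l) / M) p).
Proof.
  intros (H1 & H2 & H3 & H4) HM l.
  assert (Hl : 0 < l) by apply Rpower_pos.
  assert (Hin : forall s, - l < s < l -> -1 < s / l < 1).
  { intros s Hs. split; [apply (Rlt_div_r (-1)); lra|apply (Rlt_div_l s 1); lra]. }
  assert (Hg : forall (f : R -> R) d s k, k <> 0 -> is_derive f (s / l) d ->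
     is_derive (fun t => f (t / l) / k) s (d / (k * l))).
  { intros f d s k Hk Hf. auto_derive; [eexists; exact Hf|].
    replace (Derive (fun x => f x) (s * / l)) with d by (symmetry; apply is_derive_unique, Hf).
    field. split; [lra|assumption]. }
  split; [|split].
  - intros s Hs. apply Hg; [lra|]. apply H1, Hin, Hs.
  - intros s Hs. apply (Hg v1); [nra|]. apply H2, Hin, Hs.
  - intros s Hs Hv. rewrite H4.
    2:{ split; [apply Rdiv_lt_0_compat; lra|apply Hin; lra]. }
    rewrite spow_pos by assumption.
    (* This scaling leaves the equation invariant: v'' is divided by M l^2 = M^p, exactly as the
       nonlinearity is. *)
    assert (Hll : l * l = Rpower M (p - 1)).
    { unfold l. rewrite <- Rpower_plus. f_equal. field. }
    assert (HMp : Rpower M p = M * (l * l)).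
    { rewrite Hll. rewrite <- (Rpower_1 M) at 2 by assumption. rewrite <- Rpower_plus. f_equal. ring. }
    assert (E : Rpower (v (s / l) / M) p = Rpower (v (s / l)) p / (M * (l * l))).
    { rewrite <- HMp. apply Rmult_eq_reg_r with (Rpower M p); [|apply Rgt_not_eq, Rpower_pos].
      rewrite Rpower_mult_distr by (try assumption; apply Rdiv_lt_0_compat; assumption).
      replace (v (s / l) / M * M) with (v (s / l)) by (field; lra).
      field. apply Rgt_not_eq, Rpower_pos. }
    rewrite E. field. lra.
Qed.

Lemma norm_rescale (N : nat) (p M : R) (x : pt) :
  norm N (rescale p M x) = norm N x / Rpower M ((p - 1) / 2).
Proof.
  set (l := Rpower M ((p - 1) / 2)). assert (Hl : 0 < l) by apply Rpower_pos.
  assert (E : sumN N (fun k => rescale p M x k ^ 2) = (norm N x / l) ^ 2).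
  { replace ((norm N x / l) ^ 2) with (norm N x ^ 2 * / (l * l)) by (field; lra).
    rewrite norm_sq. induction N as [|N IH]; [simpl; ring|].
    rewrite !sumN_S, IH. unfold rescale. fold l. field. lra. }
  unfold norm at 1. rewrite E. apply sqrt_pow2. apply Rdiv_le_0_compat; [apply norm_nonneg|assumption].
Qed.

(** Common core of both parts of the theorem, stated with the rescaled profile and its equation so
    that second derivatives can be recovered. For i = 0 the estimates reach the origin; for i > 0
    the peak radius [sg] falls below any compact set that avoids the origin. *)
Lemma nodal_convergence (N : nat) (HN : (3 <= N)%nat) (m : nat)
  (u : R -> pt -> R) (r : R -> nat -> R) (M : R -> nat -> R)
  (Hu : forall p, 1 < p < pS N ->
     is_solution N p (u p) /\ radial N (u p) /\ 0 < u p origin /\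
     nodal_radii N (u p) m (r p))
  (HM : forall p, 1 < p < pS N -> forall i, (i < m)%nat ->
     is_max_abs (u p) (nodal_region N (r p) i) (M p i))
  (i : nat) (Hi : (i < m)%nat) (Rm eps : R) (HRm : 0 < Rm) (He : 0 < eps) :
  exists d, 0 < d /\ forall p, pS N - d < p < pS N ->
  exists (al sg L : R) (f f1 f2 : R -> R),
    al < 0 /\ 0 <= sg < eps /\ (i = O -> sg = 0) /\ Rm < L /\
    (forall x, (-1) ^ i * zfun p (M p i) (u p) x = f (norm N x)) /\
    (forall x, sg < norm N x < L \/ i = O /\ norm N x < L -> Ttilde N m (r p) i p (M p i) x) /\
    (forall s, al < s < L -> is_derive f s (f1 s)) /\
    (forall s, al < s < L -> is_derive f1 s (f2 s)) /\
    f1 sg = 0 /\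
    (forall s, sg < s < L -> f2 s = - (INR N - 1) / s * f1 s - Rpower (f s) p) /\
    forall s, sg <= s <= Rm ->
      Rabs (f s - bub (INR N) s) <= eps /\ Rabs (f1 s - bub1 (INR N) s) <= eps /\
      Rabs (Rpower (f s) p - Rpower (bub (INR N) s) (pS N)) <= eps.
Proof.
  set (n := INR N). set (q := pS N).
  assert (Hn : 3 <= n) by (apply (le_INR 3) in HN; simpl in HN; unfold n; lra).
  assert (Hq : q = (n + 2) / (n - 2)) by reflexivity.
  assert (Hq1 : 1 < q) by (rewrite Hq; apply (Rlt_div_r 1); lra).
  destruct (rescaled_convergence n q Rm eps Hn Hq HRm He) as [eta [Heta Hconv]].
  destruct (ef_const_exists n q Hn Hq1) as [C [HC HCp]].
  set (e := Rmin (Rmin eta eps) 1).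
  assert (Hee : 0 < e /\ e <= eta /\ e <= eps /\ e <= 1) by (unfold e, Rmin; repeat destruct Rle_dec; lra).
  (* A lower bound, independent of p, for the energy of a peak at rescaled radius at least e: 4 / (q
     - 1) bounds [ef_a p], and since e <= 1 a larger exponent gives a smaller power. *)
  set (tau := Rpower e (2 * (4 / (q - 1)) + 2) / (q + 1)).
  assert (Htau : 0 < tau) by (apply Rdiv_lt_0_compat; [apply Rpower_pos|lra]).
  destruct (energy_small n q C tau m Hn Hq Htau HC) as [d0 [Hd0 Hen]].
  exists (Rmin d0 eta). split; [apply Rmin_pos; assumption|].
  intros p Hp.
  assert (Hp0 : q - d0 < p < q /\ q - eta < p < q).
  { assert (K1 := Rmin_l d0 eta). assert (K2 := Rmin_r d0 eta). lra. }
  destruct (Hen p (proj1 Hp0)) as [Hp1 [Hdel [Ha Hsm]]].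
  assert (Hp2 : 1 < p < q) by lra.
  destruct (Hu p Hp2) as [Hsol [Hrad [Hu0 Hrr]]].
  specialize (HM p Hp2 i Hi).
  destruct (solution_profile N p (u p) HN Hsol Hrad) as [v1 [v2 HP]].
  destruct (nodal_radii_facts N m (u p) (r p) ltac:(lia) Hrr) as [Hr1 [Hr2 Hr3]].
  set (v := fun t => u p (axis t)) in *.
  assert (Hv0 : 0 < v 0).
  { unfold v. replace (u p (axis 0)) with (u p origin); [assumption|]. apply Hrad.
    rewrite norm_origin, norm_axis, Rabs_R0 by lia. reflexivity. }
  assert (Hbd := nodal_energy_bound n p C v v1 v2 m (radius0 (r p)) HP ltac:(lra) Hdel (HCp p ltac:(lra))
    Hv0 eq_refl Hr1 Hr2 Hr3 i Hi).
  destruct (Hr1 i Hi) as [Hri1 Hri2].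
  change (radius0 (r p) (S i)) with (r p (S i)) in *.
  destruct (nodal_peak N i p (M p i) (u p) (r p) v1 v2 HN HP Hrad Hu0 Hri1 Hri2
    (fun s Hs => proj1 (Hbd s Hs)) HM) as [s0 (S1 & S2 & S3 & S4 & S5 & S6)].
  set (Mi := M p i) in *. set (c := (-1) ^ i) in *.
  assert (Hc : c = 1 \/ c = -1) by apply pow_m1_cases.
  assert (HMi : 0 < Mi) by (rewrite <- S4; apply S6; lra).
  assert (HPc := profile_scale n p c v v1 v2 Hc HP).
  set (l := Rpower Mi ((p - 1) / 2)). assert (Hl : 0 < l) by apply Rpower_pos.
  destruct (rescaled_profile n p Mi _ _ _ HPc HMi) as [F1 [F2 F3]]. fold l in F1, F2, F3.
  set (f := fun t => c * v (t / l) / Mi) in *.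
  set (f1 := fun t => c * v1 (t / l) / (Mi * l)) in *.
  set (f2 := fun t => c * v2 (t / l) / (Mi * l * l)).
  set (sg := s0 * l). set (L := r p (S i) * l).
  assert (Hsg0 : 0 <= sg) by (apply Rmult_le_pos; lra).
  assert (HLl : L <= l) by (unfold L; nra).
  assert (Hdiv : forall s, sg <= s < L -> s0 <= s / l < r p (S i)).
  { intros s Hs. split; [apply (Rle_div_r s0); assumption || (unfold sg in Hs; lra)|].
    apply (Rlt_div_l s); [assumption|]. unfold L in Hs; lra. }
  (* Otherwise the peak would have energy at least tau, while the nodal bound allows at most tau /
     2. *)
  assert (Hsg : sg < e).
  { destruct (Req_dec s0 0) as [E|Hne]; [unfold sg; rewrite E; lra|].
    assert (Hi0 : (0 < i)%nat) by (destruct i; [exfalso; apply Hne, S3; reflexivity|lia]).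
    assert (Hs0 : 0 < s0) by lra.
    assert (K1 := critical_radius_energy n p Mi s0 (fun t => c * v t) (fun t => c * v1 t)
      ltac:(lra) (proj1 Hdel) Hs0 HMi S4 ltac:(cbv beta; rewrite S5; ring)).
    fold l in K1. fold sg in K1. rewrite ef_E_scale in K1 by assumption.
    destruct (Hbd s0 (conj (S2 Hi0) (proj2 S1))) as [_ K2].
    assert (K3 := Hsm i Hi).
    apply Rnot_le_lt. intros K4.
    assert (Hap : 0 < ef_a p) by (unfold ef_a; apply Rdiv_lt_0_compat; lra).
    assert (K5 : Rpower e (2 * (4 / (q - 1)) + 2) <= Rpower sg (2 * ef_a p + 2)).
    { apply Rle_trans with (Rpower e (2 * ef_a p + 2)).
      - apply Rpower_base_lt1; lra.
      - apply Rle_Rpower_l; lra. }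
    assert (K6 : tau <= Rpower sg (2 * ef_a p + 2) / (p + 1)).
    { unfold tau, Rdiv. apply Rmult_le_compat; [left; apply Rpower_pos|left; apply Rinv_0_lt_compat; lra|assumption|].
      apply Rinv_le_contravar; lra. }
    lra. }
  assert (Hf0 : f sg = 1).
  { unfold f, sg. replace (s0 * l / l) with s0 by (field; lra). change (c * v s0) with (c * u p (axis s0)). rewrite S4. field. lra. }
  assert (Hf10 : f1 sg = 0).
  { unfold f1, sg. replace (s0 * l / l) with s0 by (field; lra). rewrite S5. field. lra. }
  assert (Hode : forall s, sg < s < L -> f2 s = - (n - 1) / s * f1 s - Rpower (f s) p).
  { intros s Hs. apply F3; [lra|]. apply S6, Hdiv. lra. }
  destruct (Hconv p sg L f f1 f2) as [HL Hclose]; try lra; auto.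
  - intros s Hs. apply F1. lra.
  - intros s Hs. apply F2. lra.
  - intros s Hs. assert (K := S6 (s / l) (Hdiv s Hs)). unfold f. unfold v. split.
    + apply Rdiv_lt_0_compat; lra.
    + apply Rle_div_l; lra.
  (* Small values before L come from the zero of u at the outer radius. For the last region this
     radius is 1, so only continuity on the closed ball and the boundary condition are available
     there. *)
  - intros e0 He0.
    destruct Hsol as [_ [Hcont Hbdry]].
    set (r1 := r p (S i)) in *.
    assert (Hz : u p (axis r1) = 0).
    { destruct (Nat.eq_dec (S i) m) as [Em|Em].
      - apply Hbdry. rewrite norm_axis, Rabs_pos_eq by (lia || lra).
        destruct Hrr as (_ & _ & Rm1 & _). unfold r1. rewrite Em. exact Rm1.
      - apply (Hr2 (S i)). lia. }
    destruct (Hcont (axis r1)) with (eps := e0 * Mi) as [d1 [Hd1 K]].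
    + rewrite norm_axis, Rabs_pos_eq by (lia || lra). lra.
    + nra.
    + set (t := Rmax s0 (r1 - d1 / 2)).
      assert (Ht : s0 <= t < r1 /\ r1 - d1 < t) by (unfold t, Rmax; destruct Rle_dec; lra).
      exists (t * l). split; [split; [unfold sg|unfold L; fold r1]; nra|].
      unfold f. replace (t * l / l) with t by (field; lra).
      apply (Rlt_div_l (c * v t) e0 Mi); [assumption|].
      specialize (K (axis t)). rewrite norm_axis, dist_axis, Rabs_pos_eq in K by (lia || lra).
      specialize (K ltac:(lra) ltac:(rewrite Rabs_left; lra)).
      rewrite Hz, Rminus_0_r in K. fold (v t) in K. apply Rabs_lt_between in K.
      destruct Hc as [E|E]; rewrite E; lra.
  - exists (- l), sg, L, f, f1, f2.
    split; [lra|]. split; [lra|]. split; [intros E; unfold sg; rewrite S3 by assumption; ring|].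
    split; [assumption|]. split.
    { intros x. unfold zfun, f, v. rewrite (radial_axis N (u p) (rescale p Mi x) ltac:(lia) Hrad).
      rewrite norm_rescale. fold l. unfold Rdiv; ring. }
    split.
    { intros x Hx. exists i. split; [lia|]. unfold nodal_region. rewrite norm_rescale. fold l.
      assert (HxL : norm N x < L) by lra.
      assert (HxL' : norm N x / l < r p (S i)) by (apply (Rlt_div_l (norm N x)); [assumption|exact HxL]).
      destruct i as [|i']; [left; split; [reflexivity|assumption]|right].
      split; [lia|]. split; [|assumption].
      destruct Hx as [Hx|[Hx _]]; [|discriminate].
      assert (K := proj1 (Hdiv (norm N x) ltac:(lra))).
      assert (K2 := S2 ltac:(lia)). simpl in K2. lra. }
    split; [intros s Hs; apply F1; lra|]. split; [intros s Hs; apply F2; lra|].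
    split; [exact Hf10|]. split; [exact Hode|exact Hclose].
Qed.

(** Otherwise the origin would be a limit of points of the closed set K, hence in K. *)
Lemma compact_bounded_below (N : nat) (K : pt -> Prop) :
  compact N K -> (forall x, K x -> 0 < norm N x) ->
  exists c, 0 < c /\ forall x, K x -> c <= norm N x.
Proof.
  intros [_ Hcl] Hpos. apply NNPP. intros Hno.
  assert (K0 : K origin).
  { apply Hcl. intros eps He. apply NNPP. intros Hno2. apply Hno. exists eps. split; [assumption|].
    intros x Hx. apply Rnot_lt_le. intros Hlt. apply Hno2. exists x. split; [assumption|].
    replace (dist N origin x) with (norm N x); [assumption|].
    unfold dist, norm, origin. f_equal. apply sumN_ext. intros; ring. }
  specialize (Hpos origin K0). rewrite norm_origin in Hpos. lra.
Qed.

Lemma C2close_radial (N : nat) (F G : pt -> R) (K : pt -> Prop) (f f1 f2 g g1 g2 : R -> R) (al be eps : R) :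
  (forall x, F x = f (norm N x)) -> (forall x, G x = g (norm N x)) ->
  (forall s, al < s < be -> is_derive f s (f1 s)) -> (forall s, al < s < be -> is_derive f1 s (f2 s)) ->
  (forall s, al < s < be -> is_derive g s (g1 s)) -> (forall s, al < s < be -> is_derive g1 s (g2 s)) ->
  (al < 0 -> f1 0 - g1 0 = 0) ->
  (forall x, K x -> al < norm N x < be) ->
  (forall x, K x -> let s := norm N x in
     let Q := radial_quot (fun t => f1 t - g1 t) (fun t => f2 t - g2 t) s in
     Rabs (f s - g s) <= eps /\ Rabs Q * s <= eps /\ Rabs (f2 s - g2 s) + 2 * Rabs Q <= eps) ->
  C2close N F G K eps.
Proof.
  intros HF HG Hf Hf1 Hg Hg1 H0 HK Hb x Hx.
  assert (HH : forall y, F y - G y = (fun t => f t - g t) (norm N y)) by (intros y; rewrite HF, HG; reflexivity).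
  assert (Hh : forall s, al < s < be -> is_derive (fun t => f t - g t) s (f1 s - g1 s)).
  { intros s Hs. apply (is_derive_minus f g); auto. }
  assert (Hh1 : forall s, al < s < be -> is_derive (fun t => f1 t - g1 t) s (f2 s - g2 s)).
  { intros s Hs. apply (is_derive_minus f1 g1); auto. }
  destruct (Hb x Hx) as [B1 [B2 B3]]. split; [rewrite HF, HG; exact B1|split].
  - intros k Hk. eexists. split.
    + apply (radial_partial N _ (fun t => f t - g t) (fun t => f1 t - g1 t) (fun t => f2 t - g2 t) al be); auto.
    + rewrite Rabs_mult. eapply Rle_trans; [|exact B2].
      apply Rmult_le_compat_l; [apply Rabs_pos|apply norm_coord, Hk].
  - intros k j Hk Hj.
    destruct (radial_partial2 N _ (fun t => f t - g t) (fun t => f1 t - g1 t) (fun t => f2 t - g2 t) al be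
      HH Hh Hh1 H0 x k j (HK x Hx) Hk Hj) as [l [Hl1 Hl2]].
    exists l. split; [exact Hl1|]. eapply Rle_trans; [exact Hl2|exact B3].
Qed.

Lemma limit_bound0 (h1 h2 : R -> R) (b e : R) :
  0 < b -> is_derive h1 0 (h2 0) -> h1 0 = 0 ->
  (forall s, 0 < s < b -> Rabs (h1 s) <= e * s) -> Rabs (h2 0) <= e.
Proof.
  intros Hb Hd H0 Hle. apply le_epsilon. intros eps He.
  destruct (radial_quot_lim0 h1 h2 eps Hd H0 He) as [d [Hd0 K]].
  set (s := Rmin b d / 2). assert (Hs : 0 < s < b /\ s < d) by (unfold s, Rmin; destruct Rle_dec; lra).
  specialize (K s ltac:(rewrite Rabs_pos_eq; lra)). rewrite radial_quot_pos in K by lra.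
  specialize (Hle s ltac:(lra)).
  replace (h2 0) with (h1 s / s - (h1 s / s - h2 0)) by ring.
  eapply Rle_trans; [apply Rabs_triang|]. rewrite Rabs_Ropp.
  assert (Rabs (h1 s / s) <= e); [|lra].
  unfold Rdiv. rewrite Rabs_mult, Rabs_inv, (Rabs_pos_eq s) by lra. apply Rle_div_l; lra.
Qed.

Theorem theorem3p7 (N : nat) (HN : (3 <= N)%nat) (m : nat) (Hm : (1 <= m)%nat)
  (u : R -> pt -> R) (r : R -> nat -> R) (M : R -> nat -> R)
  (Hu : forall p, 1 < p < pS N ->
     is_solution N p (u p) /\ radial N (u p) /\ 0 < u p origin /\
     nodal_radii N (u p) m (r p))
  (HM : forall p, 1 < p < pS N -> forall i, (i < m)%nat ->
     is_max_abs (u p) (nodal_region N (r p) i) (M p i)) :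
  C2loc_conv N (fun p => zfun p (M p 0%nat) (u p))
               (fun p => Ttilde N m (r p) 0 p (M p 0%nat))
               (fun _ => True) (Ububble N) /\
  ((2 <= m)%nat -> forall i, (1 <= i <= m - 1)%nat ->
     C2loc_conv N (fun p x => (-1) ^ i * zfun p (M p i) (u p) x)
                  (fun p => Ttilde N m (r p) i p (M p i))
                  (fun x => 0 < norm N x) (Ububble N)).
Proof.
  assert (Hn : 3 <= INR N) by (apply (le_INR 3) in HN; simpl in HN; lra).
  assert (HG : forall x, Ububble N x = bub (INR N) (norm N x)) by reflexivity.
  assert (Hb1 : forall s, is_derive (bub (INR N)) s (bub1 (INR N) s)) by (intros; apply bub_derive, Hn).
  assert (Hb2 : forall s, is_derive (bub1 (INR N)) s (bub2 (INR N) s)) by (intros; apply bub1_derive, Hn).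
  split.
  - intros K [[R0 HR0] _] _.
    set (Rm := Rabs R0 + 1).
    assert (HRm : 0 < Rm) by (unfold Rm; pose proof (Rabs_pos R0); lra).
    assert (HKR : forall x, K x -> norm N x < Rm).
    { intros x Hx. specialize (HR0 x Hx). pose proof (Rle_abs R0). unfold Rm. lra. }
    split.
    + destruct (nodal_convergence N HN m u r M Hu HM 0 ltac:(lia) Rm 1 HRm ltac:(lra)) as [d [Hd H]].
      exists d. split; [assumption|]. intros p Hp x Hx.
      destruct (H p Hp) as (al & sg & L & f & f1 & f2 & _ & _ & _ & HL & _ & HT & _).
      apply HT. right. split; [reflexivity|]. specialize (HKR x Hx). lra.
    + intros eps Heps.
      (* Second derivatives cost N e for h'' and 2 e for twice Q; first derivatives cost Q times the
         radius, at most e Rm. *)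
      set (e := eps / ((INR N + 2) * (1 + Rm))).
      assert (He : 0 < e) by (apply Rdiv_lt_0_compat; [assumption|nra]).
      assert (Hee : (INR N + 2) * (1 + Rm) * e = eps) by (unfold e; field; lra).
      assert (He1 : (INR N + 2) * e <= eps) by nra.
      assert (He2 : e * Rm <= eps) by nra.
      destruct (nodal_convergence N HN m u r M Hu HM 0 ltac:(lia) Rm e HRm He) as [d [Hd H]].
      exists d. split; [assumption|]. intros p Hp.
      destruct (H p Hp) as (al & sg & L & f & f1 & f2 & Hal & _ & Hsg & HL & HF & _ & D1 & D2 & Hf10 & Hode & Hcl).
      specialize (Hsg eq_refl). subst sg.
      set (h1 := fun t => f1 t - bub1 (INR N) t). set (h2 := fun t => f2 t - bub2 (INR N) t).
      assert (Hb10 : bub1 (INR N) 0 = 0) by (unfold bub1; field; lra).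
      assert (Hh10 : h1 0 = 0) by (unfold h1; rewrite Hf10, Hb10; ring).
      assert (Hdh : forall s, 0 <= s < Rm -> is_derive h1 s (h2 s)).
      { intros s Hs. apply (is_derive_minus f1 (bub1 (INR N))); [apply D2; lra|apply Hb2]. }
      assert (Hoh : forall s, 0 < s < Rm -> h2 s = - (INR N - 1) / s * h1 s -
          (Rpower (f s) p - Rpower (bub (INR N) s) (pS N))).
      { intros s Hs. unfold h1, h2. rewrite Hode, bub_ode by lra. unfold pS. field. lra. }
      (* The difference of the two equations has right-hand side at most e, so its integrated form
         yields h1 / s <= e, and then the equation bounds h2. *)
      assert (Hfl : forall s, 0 < s < Rm -> Rabs (h1 s) <= e * s).
      { apply (flux_bound N h1 h2 (fun s => Rpower (f s) p - Rpower (bub (INR N) s) (pS N))); auto; try lia; try lra.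
        intros s Hs. apply Hcl. lra. }
      assert (HQ : forall s, 0 <= s < Rm -> Rabs (radial_quot h1 h2 s) <= e).
      { intros s Hs. destruct (Req_dec s 0) as [->|Hne].
        - unfold radial_quot. destruct Req_EM_T as [_|]; [|lra].
          apply (limit_bound0 h1 h2 Rm e); auto; apply Hdh; lra.
        - rewrite radial_quot_pos by assumption. unfold Rdiv.
          rewrite Rabs_mult, Rabs_inv, (Rabs_pos_eq s) by lra. apply Rle_div_l; [lra|]. apply Hfl. lra. }
      assert (Hh2 : forall s, 0 <= s < Rm -> Rabs (h2 s) <= INR N * e).
      { intros s Hs. assert (Q := HQ s Hs). destruct (Req_dec s 0) as [->|Hne].
        - unfold radial_quot in Q. destruct Req_EM_T as [_|]; [|lra]. nra.
        - rewrite radial_quot_pos in Q by assumption. rewrite Hoh by lra.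
          assert (C := proj2 (proj2 (Hcl s ltac:(lra)))).
          replace (- (INR N - 1) / s * h1 s) with (- ((INR N - 1) * (h1 s / s))) by (field; assumption).
          eapply Rle_trans; [apply Rabs_triang|]. rewrite !Rabs_Ropp, Rabs_mult, (Rabs_pos_eq (INR N - 1)) by lra.
          nra. }
      apply (C2close_radial N _ _ K f f1 f2 (bub (INR N)) (bub1 (INR N)) (bub2 (INR N)) al L); auto.
      * intros x. rewrite <- HF. simpl. ring.
      * intros x Hx. specialize (HKR x Hx). pose proof (norm_nonneg N x). lra.
      * intros x Hx. simpl. fold h1 h2. specialize (HKR x Hx). assert (Hx0 := norm_nonneg N x).
        assert (Q := HQ (norm N x) ltac:(lra)). assert (Q2 := Hh2 (norm N x) ltac:(lra)).
        destruct (Hcl (norm N x) ltac:(lra)) as [C1 _]. fold (h2 (norm N x)).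
        assert (Q0 := Rabs_pos (radial_quot h1 h2 (norm N x))).
        split; [nra|split; [nra|lra]].
  - intros Hm2 i Hi K HK HK0.
    destruct (compact_bounded_below N K HK HK0) as [c [Hc HKc]].
    destruct HK as [[R0 HR0] _].
    set (Rm := Rabs R0 + 1).
    assert (HRm : 0 < Rm) by (unfold Rm; pose proof (Rabs_pos R0); lra).
    assert (HKR : forall x, K x -> norm N x < Rm).
    { intros x Hx. specialize (HR0 x Hx). pose proof (Rle_abs R0). unfold Rm. lra. }
    split.
    + destruct (nodal_convergence N HN m u r M Hu HM i ltac:(lia) Rm c HRm Hc) as [d [Hd H]].
      exists d. split; [assumption|]. intros p Hp x Hx.
      destruct (H p Hp) as (al & sg & L & f & f1 & f2 & _ & Hsg & _ & HL & _ & HT & _).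
      apply HT. left. specialize (HKR x Hx). specialize (HKc x Hx). lra.
    + intros eps Heps.
      (* On K the radius is at least c, so Q <= e / c and the second derivative of the difference is
         at most (N - 1) e / c + e; adding 2 e / c gives e B. *)
      set (B := 1 + (INR N + 1) / c).
      assert (HB : 1 <= B) by (unfold B; assert (0 <= (INR N + 1) / c) by (apply Rdiv_le_0_compat; lra); lra).
      set (e := Rmin (c / 2) (eps / B)).
      assert (He : 0 < e) by (apply Rmin_pos; [lra|apply Rdiv_lt_0_compat; lra]).
      assert (Hec : e <= c / 2) by apply Rmin_l.
      assert (HeB : e * B <= eps).
      { assert (Q : e <= eps / B) by apply Rmin_r. apply (Rle_div_r e); [lra|exact Q]. }
      destruct (nodal_convergence N HN m u r M Hu HM i ltac:(lia) Rm e HRm He) as [d [Hd H]].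
      exists d. split; [assumption|]. intros p Hp.
      destruct (H p Hp) as (al & sg & L & f & f1 & f2 & Hal & Hsg & _ & HL & HF & _ & D1 & D2 & _ & Hode & Hcl).
      (* The lower end [sg] is nonnegative and below e <= c / 2: the annulus contains K and excludes
         the origin. *)
      apply (C2close_radial N _ _ K f f1 f2 (bub (INR N)) (bub1 (INR N)) (bub2 (INR N)) sg L); auto.
      * intros s Hs. apply D1. lra.
      * intros s Hs. apply D2. lra.
      * lra.
      * intros x Hx. specialize (HKR x Hx). specialize (HKc x Hx). lra.
      * intros x Hx. specialize (HKR x Hx). specialize (HKc x Hx).
        set (s := norm N x) in *. simpl.
        destruct (Hcl s ltac:(lra)) as [C1 [C2 C3]].
        rewrite radial_quot_pos by lra.
        assert (Q : Rabs ((f1 s - bub1 (INR N) s) / s) <= e / c).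
        { unfold Rdiv. rewrite Rabs_mult, Rabs_inv, (Rabs_pos_eq s) by lra.
          apply Rmult_le_compat; [apply Rabs_pos|left; apply Rinv_0_lt_compat; lra|assumption|].
          apply Rinv_le_contravar; lra. }
        assert (Q2 : Rabs ((f1 s - bub1 (INR N) s) / s) * s = Rabs (f1 s - bub1 (INR N) s)).
        { unfold Rdiv. rewrite Rabs_mult, Rabs_inv, (Rabs_pos_eq s) by lra. field. lra. }
        assert (Q3 : Rabs (f2 s - bub2 (INR N) s) <= (INR N - 1) * (e / c) + e).
        { replace (f2 s - bub2 (INR N) s) with
            (- ((INR N - 1) * ((f1 s - bub1 (INR N) s) / s)) - (Rpower (f s) p - Rpower (bub (INR N) s) (pS N))).
          - eapply Rle_trans; [apply Rabs_triang|].
            rewrite !Rabs_Ropp, Rabs_mult, (Rabs_pos_eq (INR N - 1)) by lra. nra.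
          - rewrite Hode, bub_ode by lra. unfold pS. field. lra. }
        assert (Q4 : e * B = e + (INR N + 1) * (e / c)) by (unfold B; field; lra).
        assert (e <= eps) by nra.
        split; [lra|split; [rewrite Q2; lra|lra]].
Qed.
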